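(* Let $q,p\colon\mathbb{R}\to\mathbb{R}$ be BPUC functions and, for $\lambda\in\mathbb{R}$, consider the equation $$x'=-x^2+q(t)\,x+p(t)+\lambda.\qquad(\ast)_\lambda$$ Let $\mathcal{B}_\lambda$ be the (possibly empty) set of pairs $(s,x_0)\in\mathbb{R}^2$ such that the solution of $(\ast)_\lambda$ with value $x_0$ at $t=s$ is globally defined and bounded and, when $\mathcal{B}_\lambda$ is nonempty, let $a_\lambda$ and $r_\lambda$ be the maximal and minimal bounded solutions of $(\ast)_\lambda$. Then there exists a unique $\lambda^*=\lambda^*(q,p)\in[-\|q^2/4+p\|,\|p\|\,]$ such that: (i) $\mathcal{B}_\lambda$ is empty if and only if $\lambda<\lambda^*$. (ii) If $\lambda^*\le\lambda_1<\lambda_2$, then $\mathcal{B}_{\lambda_1}\subsetneq\mathcal{B}_{\lambda_2}$. More precisely, $r_{\lambda_2}<r_{\lambda_1}\le a_{\lambda_1}<a_{\lambda_2}$. In addition, $\lim_{\lambda\to\infty}a_\lambda(t)=\infty$ and $\lim_{\lambda\to\infty}r_\lambda(t)=-\infty$ uniformly on $\mathbb{R}$. (iii) $\inf_{t\in\mathbb{R}}(a_{\lambda^*}(t)-r_{\lambda^*}(t))=0$, and $(\ast)_{\lambda^*}$ has no hyperbolic solution. (iv) If $\lambda>\lambda^*$, then $a_\lambda$ and $r_\lambda$ are uniformly separated and are the unique hyperbolic solutions of $(\ast)_\lambda$. (v) $\lambda^*(q,p+\lambda)=\lambda^*(q,p)-\lambda$ for any $\lambda\in\mathbb{R}$.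
   Context: BPUC functions: a set $\Delta=\{a_j\mid j\in\mathbb{Z}\}\subset\mathbb{R}$ is disperse if $\inf_{j\in\mathbb{Z}}(a_{j+1}-a_j)>0$. $BPUC_\Delta(\mathbb{R},\mathbb{R})$ is the set of bounded right-continuous functions $q\colon\mathbb{R}\to\mathbb{R}$ such that for all $\varepsilon>0$ there is $\delta>0$ such that, if $t_1,t_2\in(a_j,a_{j+1})$ for some $j\in\mathbb{Z}$ and $|t_2-t_1|<\delta$, then $|q(t_2)-q(t_1)|<\varepsilon$. A function $q$ is BPUC if $q=q_1+\cdots+q_n$ with $q_i\in BPUC_{\Delta_i}(\mathbb{R},\mathbb{R})$ for finitely many disperse sets $\Delta_1,\dots,\Delta_n$. $\|q\|:=\sup_{t\in\mathbb{R}}|q(t)|$. Solutions are in the Carathéodory sense (absolutely continuous on compact intervals and satisfying the equation a.e.). ''Bounded solution'' means globally defined and bounded on $\mathbb{R}$. When $\mathcal{B}_\lambda\neq\emptyset$, there are bounded solutions $r_\lambda\le a_\lambda$ with $\mathcal{B}_\lambda=\{(s,x_0)\mid r_\lambda(s)\le x_0\le a_\lambda(s)\}$. Two globally defined solutions $x_1\le x_2$ are uniformly separated if $\inf_{t\in\mathbb{R}}(x_2(t)-x_1(t))>0$. A bounded solution $\tilde b$ of $(\ast)_\lambda$ is hyperbolic if there exist $k\ge1$ and $\beta>0$ such that either $\exp\int_s^t(-2\tilde b(l)+q(l))\,dl\le k e^{-\beta(t-s)}$ whenever $t\ge s$, or $\exp\int_s^t(-2\tilde b(l)+q(l))\,dl\le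 k e^{\beta(t-s)}$ whenever $t\le s$. *)

(* Defs.v *)
From HB Require Import structures.
From mathcomp Require Import all_boot all_order all_algebra.
From mathcomp Require Import all_classical all_reals all_analysis.
Set Implicit Arguments.
Unset Strict Implicit.
Unset Printing Implicit Defensive.
Import Order.TTheory GRing.Theory Num.Theory.
Import numFieldNormedType.Exports.
Local Open Scope classical_set_scope.
Local Open Scope ring_scope.

Definition sup_norm {R : realType} (q : R -> R) : R :=
  sup (range (fun t => `|q t|)).

(* A disperse set is given by its increasing enumeration by the integers.
   The infimum of a set that is not bounded below is 0 in the library, so the
   inequality does express a positive lower bound on the gaps. *)
Definition disperse {R : realType} (Delta : int -> R) : Prop :=
  0 < inf (range (fun j : int => Delta (j + 1) - Delta j)).

Definition BPUC_on {R : realType} (Delta : int -> R) (q : R -> R) : Prop :=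
  [/\ bounded_fun q,
      (forall t : R, q x @[x --> t^'+] --> q t) &
      forall e : R, 0 < e -> exists2 d : R, 0 < d &
        forall (j : int) (t1 t2 : R),
          Delta j < t1 < Delta (j + 1) -> Delta j < t2 < Delta (j + 1) ->
          `|t2 - t1| < d -> `|q t2 - q t1| < e].

Definition BPUC {R : realType} (q : R -> R) : Prop :=
  exists (n : nat) (Delta : 'I_n -> int -> R) (qs : 'I_n -> R -> R),
    (forall i, disperse (Delta i) /\ BPUC_on (Delta i) (qs i)) /\
    q = (fun t => \sum_(i < n) qs i t).

Definition abs_continuous {R : realType} (a b : R) (x : R -> R) : Prop :=
  forall e : R, 0 < e -> exists2 d : R, 0 < d &
    forall (n : nat) (I : 'I_n -> R * R),
      (forall i, a <= (I i).1 /\ (I i).1 <= (I i).2 /\ (I i).2 <= b) ->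
      trivIset setT (fun i => `](I i).1, (I i).2[%classic : set R) ->
      \sum_(i < n) ((I i).2 - (I i).1) < d ->
      \sum_(i < n) `|x (I i).2 - x (I i).1| < e.

(* Globally defined Caratheodory solutions of x' = - x^2 + q x + p + lam. *)
Definition solution {R : realType} (q p : R -> R) (lam : R) (x : R -> R) :
    Prop :=
  (forall a b : R, abs_continuous a b x) /\
  {ae lebesgue_measure, forall t : R,
    is_derive t 1 x (- x t ^+ 2 + q t * x t + p t + lam)}.

Definition bounded_solution {R : realType} (q p : R -> R) (lam : R)
    (b : R -> R) : Prop :=
  solution q p lam b /\ bounded_fun b.

Definition bounded_pairs {R : realType} (q p : R -> R) (lam : R) : set (R * R) :=
  [set sx | exists2 b, bounded_solution q p lam b & b sx.1 = sx.2].

Definition maximal_bounded_solution {R : realType} (q p : R -> R) (lam : R)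
    (a : R -> R) : Prop :=
  bounded_solution q p lam a /\
  forall b, bounded_solution q p lam b -> forall t, b t <= a t.

Definition minimal_bounded_solution {R : realType} (q p : R -> R) (lam : R)
    (r : R -> R) : Prop :=
  bounded_solution q p lam r /\
  forall b, bounded_solution q p lam b -> forall t, r t <= b t.

(* The maximal and minimal bounded solutions are unique when they exist; the
   value 0 outside this case is irrelevant. *)
Definition a_sol {R : realType} (q p : R -> R) (lam : R) : R -> R :=
  xget (cst 0) [set a | maximal_bounded_solution q p lam a].

Definition r_sol {R : realType} (q p : R -> R) (lam : R) : R -> R :=
  xget (cst 0) [set r | minimal_bounded_solution q p lam r].

Definition uniformly_separated {R : realType} (x1 x2 : R -> R) : Prop :=
  0 < inf (range (fun t => x2 t - x1 t)).

Definition oriented_integral {R : realType} (s t : R) (f : R -> R) : R :=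
  if s <= t then \int[lebesgue_measure]_(l in `[s, t]) f l
  else - \int[lebesgue_measure]_(l in `[t, s]) f l.

Definition hyperbolic {R : realType} (q p : R -> R) (lam : R) (b : R -> R) :
    Prop :=
  bounded_solution q p lam b /\
  exists k beta : R, [/\ 1 <= k, 0 < beta &
    (forall s t : R, s <= t ->
       expR (oriented_integral s t (fun l => - 2 * b l + q l))
         <= k * expR (- beta * (t - s))) \/
    (forall s t : R, t <= s ->
       expR (oriented_integral s t (fun l => - 2 * b l + q l))
         <= k * expR (beta * (t - s)))].

(* The properties determining the bifurcation value l = lambda^*(q, p); the
   second one alone already makes l unique. *)
Definition is_lambda_star {R : realType} (q p : R -> R) (l : R) : Prop :=
  let B := bounded_pairs q p in
  let a := a_sol q p in
  let r := r_sol q p in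
  [/\ - sup_norm (fun t => q t ^+ 2 / 4 + p t) <= l <= sup_norm p,
      (forall lam, B lam = set0 <-> lam < l),
      [/\ (forall lam1 lam2, l <= lam1 -> lam1 < lam2 ->
             B lam1 `<` B lam2 /\
             forall t, [/\ r lam2 t < r lam1 t, r lam1 t <= a lam1 t &
                           a lam1 t < a lam2 t]),
          (forall M : R, \forall lam \near +oo, forall t, M < a lam t) &
          (forall M : R, \forall lam \near +oo, forall t, r lam t < M)],
      inf (range (fun t => a l t - r l t)) = 0 /\
        ~ (exists b, hyperbolic q p l b) &
      (forall lam, l < lam ->
         uniformly_separated (r lam) (a lam) /\
         forall b, hyperbolic q p lam b <-> b = a lam \/ b = r lam)].

(* Main.v *)
Require Import Defs.
From HB Require Import structures.
From mathcomp Require Import all_boot all_order all_algebra.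
From mathcomp Require Import all_classical all_reals all_analysis.
From mathcomp Require Import measurable_realfun ring lra.

(** The argument runs on lower solutions: bounded functions [w] with
    [w' <= - w ^+ 2 + q w + p + lam] almost everywhere.  As soon as one exists,
    there is a bounded solution above it ([bounded_solution_above]), obtained on
    the whole line at once, with no initial value problem: for a large constant
    [K], replacing [x] by the bounded solution [y] of
    [y' = - K y + (K x - x ^+ 2 + q x + p + lam)] is a monotone operation on the
    strip [|x| <= M], and its iterates from the constant [M] decrease to a bounded
    solution that dominates all lower solutions of the strip.  Since every bounded
    solution lies in an explicit strip ([bounded_riccati_strip]), this gives the
    maximal bounded solution [a].  The change of variables
    [x(t) |-> - x(- t)], [q(t) |-> - q(- t)], [p(t) |-> p(- t)] exchanges [a] and
    the minimal bounded solution [r], and attractive and repulsive hyperbolicity,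
    so that only one half of each statement has to be proved.  The solutions
    lying between [r] and [a] are explicit, because the cross-ratio type quotient
    [(x - r) / (a - x)] of a Riccati equation satisfies a linear equation.

    The set of parameters with a bounded solution is upward closed, since a
    solution for [lam] is a lower solution for larger parameters.  It contains
    [sup_norm p], for which 0 is a lower solution; it is bounded below, since
    completing the square gives [x' <= q ^+ 2 / 4 + p + lam]; it is closed, by
    dominated convergence along maximal solutions ([solvable_closed]).  Its
    infimum is the bifurcation value [l].  The other properties of [l] come from
    writing down lower solutions.
    - For [lam1 < lam2], a solution for [lam1] raised by a small constant is a
      lower solution for [lam2]: strict, even uniform, monotonicity
      ([strictly_above]).  Large constants give the limits at infinity.
    - If two solutions for [lam] are at distance at least [delta], their mean is
      a lower solution for [lam - delta ^+ 2 / 4] ([solvable_of_separated]).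
      Hence [a] and [r] are not uniformly separated at [l].
    - If [b] is attractive hyperbolic for [lam], let [phi] be the bounded solution
      of [phi' = (- 2 b + q) phi + 1]; then [b - eps phi] is a lower solution for
      [lam - eps / 2] when [eps] is small ([attractive_solvable]).  Hence there
      is no hyperbolic solution at [l].
    - For [lam > l] the solutions [a] and [r] are uniformly separated by strict
      monotonicity, and [- 2 a + q] is the logarithmic derivative of [a - r]
      minus [a - r], so that [a] is attractive ([separated_attractive]).  An
      attractive hyperbolic solution [b] is above every bounded solution [c],
      because [b - c] satisfies a linear differential inequality along which
      negative values would blow up in the past ([attractive_maximal]); this
      gives uniqueness.

    On the analytic side, everything is expressed through the relation
    [antider f g], that [f] is locally Lipschitz with derivative [g] almost
    everywhere.  A bounded Caratheodory solution has a bounded derivative, hence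
    is of this kind, by the monotonicity of absolutely continuous functions whose
    derivative is nonnegative almost everywhere
    ([derivative_ge0_abs_continuous_le]). *)

Import Order.TTheory GRing.Theory Num.Theory.
Import numFieldNormedType.Exports.
Local Open Scope classical_set_scope.
Local Open Scope ring_scope.
Set Implicit Arguments.
Unset Strict Implicit.
Unset Printing Implicit Defensive.

(** * Absolutely continuous functions with a nonnegative derivative *)

(** Induction along an interval: near each point [T], the property passes from
    the left of [T] to the right of [T], and compactness, in the form of a
    supremum, does the rest. *)
Lemma real_induction (R : realType) (P : R -> Prop) (a b : R) :
  a <= b -> P a ->
  (forall T, a <= T <= b -> exists2 eta, 0 < eta & forall s t,
     a <= s -> s <= T -> T <= t -> t <= b -> T - eta < s -> t < T + eta ->
     P s -> P t) ->
  P b.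
Proof.
move=> ab Pa step.
pose S := [set x | a <= x <= b /\ P x].
have Sa : S a by split => //; rewrite lexx.
have supS : has_sup S by split; [exists a | exists b => x [/andP[]]].
have aT : a <= sup S by apply: ub_le_sup => //; case: supS.
have Tb : sup S <= b by apply: ge_sup; [exists a | move=> x [/andP[]]].
have [|eta eta0 loc] := step (sup S); first by rewrite aT.
have [s [/andP[as_ sb] Ps] Ts] := sup_adherent eta0 supS.
have sT : s <= sup S by apply: ub_le_sup; [case: supS | split; [apply/andP|]].
have PT t : sup S <= t -> t <= b -> t < sup S + eta -> P t.
  by move=> *; apply: (loc s).
have [bT|bT] := leP b (sup S + eta / 2).
  by apply: PT => //; apply: le_lt_trans bT _; lra.
have : sup S + eta / 2 <= sup S.
  apply: ub_le_sup; first by case: supS.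
  split; first by apply/andP; split; lra.
  by apply: PT; lra.
by move=> H; exfalso; lra.
Qed.

Lemma is_derive_local (R : realType) (f : R -> R) (x d : R) :
  is_derive x 1 f d ->
  forall e, 0 < e -> exists2 eta, 0 < eta &
    forall y, `|y - x| < eta -> `|f y - f x - d * (y - x)| <= e * `|y - x|.
Proof.
move=> /is_derive1_caratheodory[g [fE gc gx]] e e0.
have /cvgrPdist_lt/(_ _ e0)/nbhs_ballP[eta /= eta0 He] : g z @[z --> x] --> g x by [].
exists eta => // y yx; rewrite fE -mulrBl normrM ler_wpM2r//.
rewrite distrC -gx; apply/ltW/He.
by rewrite /ball/= distrC.
Qed.

(** The exceptional null set is covered by an open set [U] of measure smaller than
    the [dlt] of absolute continuity.  Moving along [a, b], [f] loses at most
    [e1] per unit of length around the points outside [U], where the derivative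
    is nonnegative; around a point of [U] a whole interval lies in [U], and is
    added to a finite family of disjoint intervals whose total length stays
    below the measure of [U], so that the loss on this family is small. *)
Lemma derivative_ge0_abs_continuous_le (R : realType) (f : R -> R) (a b : R) :
  a <= b -> abs_continuous a b f ->
  {ae lebesgue_measure, forall t : R, a <= t <= b ->
     exists2 d : R, 0 <= d & is_derive t 1 f d} ->
  f a <= f b.
Proof.
move=> ab acf aef.
apply/ler_addgt0Pr => e e0.
pose e1 := e / 2 / (b - a + 1).
have ba1 : 0 < b - a + 1 by lra.
have e10 : 0 < e1 by rewrite !divr_gt0.
have [dlt dlt0 acd] := acf (e / 2) ltac:(lra).
have N0 := (negligible_outer_measure _).1 aef.
have [U [oU NU muU]] := outer_measure_open_le (~` [set t | a <= t <= b ->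
     exists2 d : R, 0 <= d & is_derive t 1 f d]) (divr_gt0 dlt0 (ltr0n R 2)).
rewrite N0 add0e in muU.
have mU : measurable U by exact: open_measurable.
(* Bounding the total length by the measure of [U] to the left of [t], and not
   of [U] itself, is what allows the family to be extended. *)
pose P t := exists (n : nat) (I : 'I_n -> R * R),
  [/\ (forall i, a <= (I i).1 /\ (I i).1 <= (I i).2 /\ (I i).2 <= t),
      trivIset setT (fun i => `](I i).1, (I i).2[%classic : set R),
      ((\sum_(i < n) ((I i).2 - (I i).1))%:E <=
        lebesgue_measure (U `&` [set` `[a, t]]))%E &
      f a <= f t + e1 * (t - a) + \sum_(i < n) `|f (I i).2 - f (I i).1|].
suff [n [I [Iab tI lI fab]]] : P b.
  have lenI : \sum_(i < n) ((I i).2 - (I i).1) < dlt.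
    rewrite -lte_fin; apply: le_lt_trans lI _.
    apply: (@le_lt_trans _ _ (lebesgue_measure U)).
      apply: le_measure; rewrite ?inE//; exact: measurableI.
    apply: le_lt_trans muU _; rewrite lte_fin; lra.
  have := acd n I Iab tI lenI.
  have : e1 * (b - a) <= e / 2.
    rewrite /e1 mulrAC ler_pdivrMr// ler_pM2l; lra.
  lra.
apply: (@real_induction _ P a b ab).
  exists 0%N, (fun=> (0, 0)); split.
  - by case.
  - by case.
  - by rewrite big_ord0 measure_ge0.
  - by rewrite big_ord0 subrr mulr0 !addr0.
move=> T aTb; have [TU|TU] := pselect (U T); last first.
  have [d d0 dT] : exists2 d : R, 0 <= d & is_derive T 1 f d.
    by apply: contrapT => H; apply: TU; apply: NU => /= /(_ aTb).
  have [eta eta0 He] := is_derive_local dT e10.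
  exists eta => // s t as_ sT Tt tb sT' tT' [n [I [Iab tI lI fab]]].
  exists n, I; split => //.
  - by move=> i; have [? [? ?]] := Iab i; split => //; split => //; lra.
  - apply: le_trans lI _; apply: le_measure; rewrite ?inE//; try exact: measurableI.
    apply: setIS => x /=; rewrite !in_itv/= => /andP[-> xs] /=; lra.
  - apply: le_trans fab _; rewrite lerD2r.
    have Hs : `|s - T| < eta by rewrite distrC ger0_norm; lra.
    have Ht : `|t - T| < eta by rewrite ger0_norm; lra.
    have := He _ Hs; have := He _ Ht.
    rewrite [`|s - T|]distrC (@ger0_norm _ (T - s)) ?(@ger0_norm _ (t - T)) ?subr_ge0//.
    rewrite !ler_norml => /andP[h1 h2] /andP[h3 h4].
    have k1 : 0 <= d * (t - T) by rewrite mulr_ge0// subr_ge0.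
    have k2 : 0 <= d * (T - s) by rewrite mulr_ge0// subr_ge0.
    lra.
(* [T] lies in [U]: the interval from [s] to [t] joins the family. *)
have /nbhs_ballP[eta /= eta0 Beta] := open_nbhs_nbhs (conj oU TU).
exists eta => // s t as_ sT Tt tb sT' tT' [n [I [Iab tI lI fab]]].
pose J (i : 'I_n.+1) := oapp I (s, t) (unlift ord_max i).
have JE (i : 'I_n) : J (widen_ord (leqnSn n) i) = I i.
  have H : widen_ord (leqnSn n) i = lift ord_max i.
    by apply: val_inj => /=; rewrite /bump leqNgt (ltn_ord i).
  by rewrite H /J liftK.
have Jm : J ord_max = (s, t) by rewrite /J unlift_none.
exists n.+1, J; split.
- move=> i; rewrite /J; case: unliftP => [j _|_] /=; last by lra.
  by have [? [? ?]] := Iab j; split => //; split => //; lra.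
- move=> i j _ _; rewrite /J.
  case: (unliftP ord_max i) => [i' ->|->]; case: (unliftP ord_max j) => [j' ->|->] //=.
  + by move=> /(tI _ _ Logic.I Logic.I) ->.
  + move=> [x [/=]]; rewrite !in_itv/= => /andP[? ?] /andP[? ?].
    by exfalso; have [? [? ?]] := Iab i'; lra.
  + move=> [x [/=]]; rewrite !in_itv/= => /andP[? ?] /andP[? ?].
    by exfalso; have [? [? ?]] := Iab j'; lra.
- rewrite big_ord_recr/= Jm/= (eq_bigr (fun i => (I i).2 - (I i).1)); last first.
    by move=> i _; rewrite JE.
  rewrite EFinD.
  apply: (@le_trans _ _ (lebesgue_measure (U `&` [set` `[a, s]]) +
                         lebesgue_measure [set` `]s, t]])%E).
    apply: leeD => //.
    by rewrite lebesgue_measure_itv/= lte_fin; case: ltP => //; rewrite ?lee_fin ?subr_le0.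
  rewrite -(measureU (@lebesgue_measure R))//=; last 2 first.
    exact: measurableI.
    by apply/seteqP; split => x //=; rewrite !in_itv/= => -[[_ ?] ?]; lra.
  apply: le_measure; rewrite ?inE//.
    by apply: measurableU => //; exact: measurableI.
    exact: measurableI.
  move=> x [[Ux]|]/=; rewrite !in_itv/= => /andP[? ?]; split => //=; try lra.
  apply: Beta; rewrite /ball/= ltr_norml; lra.
- rewrite big_ord_recr/= Jm/= (eq_bigr (fun i => `|f (I i).2 - f (I i).1|)); last first.
    by move=> i _; rewrite JE.
  have := ler_norm (f s - f t); rewrite distrC.
  have : e1 * (s - a) <= e1 * (t - a) by rewrite ler_pM2l//; lra.
  lra.
Qed.

(** * Locally Lipschitz antiderivatives *)

Definition loc_lipschitz (R : realType) (f : R -> R) : Prop :=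
  forall M, exists2 L, 0 <= L &
    forall s t, `|s| <= M -> `|t| <= M -> `|f s - f t| <= L * `|s - t|.

Definition loc_bounded (R : realType) (f : R -> R) : Prop :=
  forall M, exists C, forall t, `|t| <= M -> `|f t| <= C.

(** Locally Lipschitz rather than absolutely continuous: the class is then stable
    under products and under composition with smooth functions, and it contains
    all the functions that occur. *)
Definition antider (R : realType) (f g : R -> R) : Prop :=
  loc_lipschitz f /\ {ae lebesgue_measure, forall t : R, is_derive t 1 f (g t)}.

Lemma loc_lipschitz_bounded (R : realType) (f : R -> R) :
  loc_lipschitz f -> loc_bounded f.
Proof.
move=> lf M; have [L L0 Lf] := lf M; exists (`|f 0| + L * M) => t tM.
have := Lf t 0 tM; rewrite normr0 subr0 => /(_ (le_trans (normr_ge0 _) tM)).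
have := ler_normD (f t - f 0) (f 0); rewrite subrK.
have : L * `|t| <= L * M by rewrite ler_wpM2l.
lra.
Qed.

Lemma loc_lipschitz_continuous (R : realType) (f : R -> R) :
  loc_lipschitz f -> continuous f.
Proof.
move=> lf x; have [L L0 Lf] := lf (`|x| + 1).
apply/cvgrPdist_le => e e0.
have L1 : 0 < L + 1 by lra.
have e1 : 0 < Num.min 1 (e / (L + 1)) by rewrite lt_min ltr01 divr_gt0.
near=> y.
have xy : `|x - y| < Num.min 1 (e / (L + 1)).
  by near: y; exists (Num.min 1 (e / (L + 1))).
move: xy; rewrite lt_min ltr_pdivlMr// => /andP[xy1 xye].
apply: (@le_trans _ _ (L * `|x - y|)).
  apply: Lf; first by rewrite lerDl.
  have := ler_normD x (y - x); rewrite addrC subrK distrC; lra.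
by apply: le_trans (ltW xye); rewrite mulrC ler_wpM2l// lerDl.
Unshelve. all: by end_near. Qed.

Lemma loc_lipschitz_abs_continuous (R : realType) (f : R -> R) (a b : R) :
  loc_lipschitz f -> abs_continuous a b f.
Proof.
move=> lf e e0; have [L L0 Lf] := lf (Num.max `|a| `|b|).
have L1 : 0 < L + 1 by lra.
exists (e / (L + 1)); first by rewrite divr_gt0.
move=> n I Iab _; rewrite ltr_pdivlMr// => lI.
have bnd x : a <= x -> x <= b -> `|x| <= Num.max `|a| `|b|.
  move=> ax xb; have := ler_norm b; have := ler_norm (- a); rewrite normrN => ha hb.
  rewrite le_max; have [x0|x0] := leP 0 x; apply/orP; [right|left].
    by rewrite ger0_norm//; lra.
  by rewrite ltr0_norm//; lra.
have S0 : 0 <= \sum_(i < n) ((I i).2 - (I i).1).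
  by apply: sumr_ge0 => i _; rewrite subr_ge0; case: (Iab i) => ? [].
apply: (@le_lt_trans _ _ (L * \sum_(i < n) ((I i).2 - (I i).1))).
  rewrite mulr_sumr; apply: ler_sum => i _.
  have [? [? ?]] := Iab i.
  rewrite -[X in L * X]ger0_norm ?subr_ge0//; apply: Lf; apply: bnd; lra.
by apply: le_lt_trans lI; rewrite mulrC ler_wpM2l// lerDl.
Qed.

Lemma lebesgue_aeS (R : realType) (P Q : R -> Prop) : (forall t, P t -> Q t) ->
  {ae lebesgue_measure, forall t, P t} -> {ae lebesgue_measure, forall t, Q t}.
Proof.
by move=> PQ; apply: filterS => //; exact: (ae_filter_ringOfSetsType (@lebesgue_measure R)).
Qed.

Lemma lebesgue_aeS2 (R : realType) (P Q S : R -> Prop) :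
  (forall t, P t -> Q t -> S t) -> {ae lebesgue_measure, forall t, P t} ->
  {ae lebesgue_measure, forall t, Q t} -> {ae lebesgue_measure, forall t, S t}.
Proof.
by move=> PQS; apply: filterS2 => //; exact: (ae_filter_ringOfSetsType (@lebesgue_measure R)).
Qed.

Section antider_calculus.
Variable R : realType.
Implicit Types f g h k : R -> R.

Lemma antider_eq f g f' g' : antider f g -> f =1 f' -> g =1 g' -> antider f' g'.
Proof. by move=> fg /funext<- /funext<-. Qed.

Lemma antider_lin (K c : R) : antider (fun t => K * t + c) (fun=> K).
Proof.
split.
  move=> M; exists `|K| => // s t _ _.
  by rewrite opprD addrACA subrr addr0 -mulrBr normrM.
apply: aeW => t; apply/is_derive1_caratheodory; exists (fun=> K).
by split => // [z|]; [lra | exact: cvg_cst].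
Qed.

Lemma antider_cst (c : R) : antider (fun=> c) (fun=> 0).
Proof. by apply: (antider_eq (antider_lin 0 c)) => // t; rewrite mul0r add0r. Qed.

Lemma antiderD f g h k : antider f h -> antider g k ->
  antider (fun t => f t + g t) (fun t => h t + k t).
Proof.
move=> [lf df] [lg dg]; split.
  move=> M; have [L L0 Lf] := lf M; have [K K0 Kg] := lg M.
  exists (L + K); first by rewrite addr_ge0.
  move=> s t sM tM; rewrite opprD addrACA (le_trans (ler_normD _ _))// mulrDl.
  by rewrite lerD ?Lf ?Kg.
apply: lebesgue_aeS2 df dg => t dft dgt; exact: (is_deriveD dft dgt).
Qed.

Lemma antiderM f g h k : antider f h -> antider g k ->
  antider (fun t => f t * g t) (fun t => h t * g t + f t * k t).
Proof.
move=> [lf df] [lg dg]; split.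
  move=> M; have [L L0 Lf] := lf M; have [K K0 Kg] := lg M.
  have [C Cf] := loc_lipschitz_bounded lf M.
  have [D Dg] := loc_lipschitz_bounded lg M.
  exists (`|C| * K + L * `|D|); first by rewrite addr_ge0// mulr_ge0.
  move=> s t sM tM.
  have -> : f s * g s - f t * g t = f s * (g s - g t) + (f s - f t) * g t by ring.
  rewrite (le_trans (ler_normD _ _))// !normrM.
  have -> : (`|C| * K + L * `|D|) * `|s - t| =
    `|C| * (K * `|s - t|) + L * `|s - t| * `|D| by ring.
  apply: lerD; apply: ler_pM => //.
  - by rewrite (le_trans (Cf _ sM))// ler_norm.
  - exact: Kg.
  - exact: Lf.
  - by rewrite (le_trans (Dg _ tM))// ler_norm.
apply: lebesgue_aeS2 df dg => t dft dgt.
apply: (is_derive_eq (is_deriveM dft dgt)).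
by rewrite /GRing.scale/= addrC mulrC.
Qed.

Lemma antiderZ (c : R) f h : antider f h ->
  antider (fun t => c * f t) (fun t => c * h t).
Proof.
move=> fh; apply: (antider_eq (antiderM (antider_cst c) fh)) => // t /=.
by rewrite mul0r add0r.
Qed.

Lemma antiderN f h : antider f h -> antider (fun t => - f t) (fun t => - h t).
Proof. by move=> fh; apply: (antider_eq (antiderZ (-1) fh)) => t; rewrite mulN1r. Qed.

Lemma antiderB f g h k : antider f h -> antider g k ->
  antider (fun t => f t - g t) (fun t => h t - k t).
Proof. by move=> fh gk; exact: antiderD fh (antiderN gk). Qed.

Lemma is_derive_chain (phi : R -> R) f (x d e : R) :
  is_derive x 1 f d -> is_derive (f x) 1 phi e ->
  is_derive x 1 (fun t => phi (f t)) (e * d).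
Proof.
move=> /is_derive1_caratheodory[u [fE cu ux]].
move=> /is_derive1_caratheodory[v [pE cv vx]].
have cf : {for x, continuous f}.
  have -> : f = fun z => f x + u z * (z - x).
    by apply/funext => z; rewrite -fE addrC subrK.
  by apply: cvgD; [exact: cvg_cst|apply: cvgM => //; apply: cvgB => //; exact: cvg_cst].
apply/is_derive1_caratheodory; exists (fun z => v (f z) * u z); split.
- by move=> z; rewrite pE fE mulrA.
- by apply: cvgM => //; apply: (cvg_comp _ _ cf); exact: cv.
- by rewrite ux vx.
Qed.

Lemma antider_comp (phi dphi : R -> R) f h :
  (forall t, is_derive (f t) 1 phi (dphi (f t))) ->
  (forall C, exists2 L, 0 <= L & forall s t : R, `|f s| <= C -> `|f t| <= C ->
     `|phi (f s) - phi (f t)| <= L * `|f s - f t|) ->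
  antider f h -> antider (fun t => phi (f t)) (fun t => dphi (f t) * h t).
Proof.
move=> dp lp [lf df]; split; last first.
  by apply: lebesgue_aeS df => t dft; exact: is_derive_chain dft (dp t).
move=> M; have [L L0 Lf] := lf M.
have [C Cf] := loc_lipschitz_bounded lf M.
have [K K0 Kp] := lp C.
exists (K * L); first by rewrite mulr_ge0.
move=> s t sM tM; apply: (le_trans (Kp s t (Cf _ sM) (Cf _ tM))).
by rewrite -mulrA ler_wpM2l// Lf.
Qed.

Lemma antider_expR f h : antider f h ->
  antider (fun t => expR (f t)) (fun t => expR (f t) * h t).
Proof.
apply: antider_comp => // C; exists (expR C); first exact: expR_ge0.
have main x y : y <= x -> `|x| <= C -> `|expR x - expR y| <= expR C * `|x - y|.
  move=> yx xC; rewrite !ger0_norm ?subr_ge0 ?ler_expR//.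
  have -> : expR x - expR y = expR x * (1 - expR (y - x)).
    by rewrite mulrBr mulr1 -expRD; congr (_ - expR _); ring.
  apply: ler_pM; rewrite ?expR_ge0 ?subr_ge0 ?ler_expR ?expR_le1 ?subr_le0//.
    exact: le_trans (ler_norm _) xC.
  have := expR_ge1Dx (y - x); lra.
move=> s t sC tC; have [ts|st] := leP (f t) (f s); first exact: main.
by rewrite distrC [X in _ * X]distrC; apply: main => //; exact: ltW.
Qed.

Lemma antider_inv f h : (forall t, 1 <= f t) -> antider f h ->
  antider (fun t => (f t)^-1) (fun t => - (f t) ^- 2 * h t).
Proof.
move=> f1 fh.
have f0 t : f t != 0 by have := f1 t; apply: contraTneq => ->; rewrite -ltNge.
apply: (@antider_comp (fun x => x^-1) (fun x => - x ^- 2)) fh.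
  move=> t; have := @is_deriveV R id (f t) 1 1 (f0 t) _.
  by move=> /(_ (is_derive_id _ _)) H; apply: (is_derive_eq H); rewrite /GRing.scale/= mulr1.
move=> C; exists 1 => // s t _ _.
have -> : (f s)^-1 - (f t)^-1 = (f t - f s) / (f s * f t).
  by field; rewrite f0 f0.
have st1 : 1 <= f s * f t by rewrite mulr_ege1.
rewrite normrM normfV mul1r distrC (@ger0_norm _ (f s * f t)); last by lra.
by rewrite ler_pdivrMr ?ler_peMr//; lra.
Qed.

Lemma antider_ge0_le f g s t : antider f g -> s <= t ->
  (forall u, s <= u <= t -> 0 <= g u) -> f s <= f t.
Proof.
move=> [lf df] st g0; apply: derivative_ge0_abs_continuous_le => //.
  exact: loc_lipschitz_abs_continuous.
by apply: lebesgue_aeS df => u dfu /g0 gu; exists (g u).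
Qed.

Lemma antider_le f g h k s t : antider f h -> antider g k -> s <= t ->
  (forall u, s <= u <= t -> h u <= k u) -> f t - f s <= g t - g s.
Proof.
move=> fh gk st hk.
have := antider_ge0_le (antiderB gk fh) st.
have H : forall u, s <= u <= t -> 0 <= k u - h u by move=> u /hk; rewrite subr_ge0.
by move=> /(_ H); lra.
Qed.

Lemma antider_unique f g h s t : antider f h -> antider g h -> f t - f s = g t - g s.
Proof.
move=> fh gh; have [st|ts] := leP s t.
  by apply/eqP; rewrite eq_le (antider_le fh gh)// (antider_le gh fh).
have ts' := ltW ts.
apply: oppr_inj; rewrite !opprB.
by apply/eqP; rewrite eq_le (antider_le fh gh)// (antider_le gh fh).
Qed.

(** Adding the linear function [C t] to [f] or to [- f] makes the derivative
    nonnegative almost everywhere. *)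
Lemma abs_continuous_loc_lipschitz f g (C : R) :
  (forall a b : R, abs_continuous a b f) -> (forall t, `|g t| <= C) ->
  {ae lebesgue_measure, forall t : R, is_derive t 1 f (g t)} ->
  loc_lipschitz f.
Proof.
move=> acf gC df.
have C0 : 0 <= C by apply: le_trans (gC 0).
have aclin h a b : abs_continuous a b h -> abs_continuous a b (fun t => C * t + h t).
  move=> ach e e0; have [d d0 hd] := ach (e / 2) ltac:(lra).
  have C1 : 0 < C + 1 by lra.
  have e2 : 0 < e / 2 / (C + 1) by rewrite !divr_gt0.
  exists (Num.min d (e / 2 / (C + 1))); first by rewrite lt_min d0.
  move=> n I Iab tI; rewrite lt_min => /andP[/(hd _ _ Iab tI) h1].
  rewrite ltr_pdivlMr// => h2.
  apply: (@le_lt_trans _ _ (\sum_(i < n) (((I i).2 - (I i).1) * (C + 1) +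
     `|h (I i).2 - h (I i).1|))).
    apply: ler_sum => i _; have [? [i12 ?]] := Iab i.
    rewrite opprD addrACA -mulrBr (le_trans (ler_normD _ _))// lerD2r.
    rewrite ger0_norm ?mulr_ge0 ?subr_ge0// mulrC ler_wpM2l ?subr_ge0// lerDl//.
  by rewrite big_split/= -mulr_suml; lra.
have key h k s t : (forall a b : R, abs_continuous a b h) ->
    {ae lebesgue_measure, forall t : R, is_derive t 1 h (k t)} ->
    (forall t, `|k t| <= C) -> s <= t -> h s - h t <= C * (t - s).
  move=> ach dh kC st.
  suff : C * s + h s <= C * t + h t by lra.
  apply: (@derivative_ge0_abs_continuous_le _ (fun t => C * t + h t)) => //.
    exact: aclin.
  apply: lebesgue_aeS dh => u du _; exists (C * 1 + k u).
    by have := kC u; rewrite ler_norml; lra.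
  exact: (is_deriveD (is_deriveZ C (is_derive_id u 1)) du).
have two s t : s <= t -> `|f s - f t| <= C * `|s - t|.
  move=> st; rewrite [X in _ * X]distrC [`|t - s|]ger0_norm ?subr_ge0// ler_norml.
  rewrite (key f g)// andbT.
  suff : - f s - - f t <= C * (t - s) by lra.
  apply: (key (fun t => - f t) (fun t => - g t) s t _ _ _ st).
  - move=> a b e e0; have [d d0 Hd] := acf a b e e0; exists d => // n I Iab tI lI.
    rewrite (eq_bigr (fun i => `|f (I i).2 - f (I i).1|)) ?Hd// => i _.
    by rewrite -normrN opprD !opprK.
  - by apply: lebesgue_aeS df => u du; exact: is_deriveN.
  - by move=> u; rewrite normrN.
move=> M; exists C => // s t _ _.
have [st|/ltW ts] := leP s t; first exact: two.
by rewrite distrC [X in _ * X]distrC two.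
Qed.

End antider_calculus.

(** * Antiderivatives and the Lebesgue integral *)

Section antider_integral.
Variable R : realType.
Implicit Types f g h : R -> R.
Notation mu := (@lebesgue_measure R).

Lemma loc_bounded_integrable h (a b : R) : measurable_fun setT h ->
  loc_bounded h -> mu.-integrable `[a, b] (EFin \o h).
Proof.
move=> mh bh; apply: measurable_bounded_integrable => //.
- by rewrite /= lebesgue_measure_itv/=; case: ifP => // _; rewrite -EFinB ltry.
- exact: measurable_funTS.
- have [C hC] := bh (Num.max `|a| `|b|).
  exists C; split; first exact: num_real.
  move=> x Cx t /=; rewrite in_itv/= => /andP[at_ tb].
  apply: le_trans (ltW Cx); apply: hC; rewrite le_max.
  have := ler_norm b; have := ler_norm (- a); rewrite normrN => ha hb.
  have [t0|t0] := leP 0 t; apply/orP; [right|left].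
    by rewrite ger0_norm//; lra.
  by rewrite ltr0_norm//; lra.
Qed.

Lemma loc_bounded_locally_integrable h : measurable_fun setT h ->
  loc_bounded h -> locally_integrable setT h.
Proof.
move=> mh bh; split => //; first exact: openT.
move=> K _ cK; have [M [_ KM]] := compact_bounded cK.
have KI : K `<=` `[- (`|M| + 1), `|M| + 1].
  move=> x Kx /=; rewrite in_itv/= -ler_norml; apply: KM => //.
  by have := ler_norm M; lra.
have mK : measurable K by exact: compact_measurable.
have /integrableP[_] := loc_bounded_integrable (- (`|M| + 1)) (`|M| + 1) mh bh.
apply: le_lt_trans; apply: ge0_subset_integral => //.
by apply/measurable_EFinP; apply: measurableT_comp => //; exact: measurable_funTS.
Qed.

(** Lebesgue differentiation applies on the half-lines that start at [- n]; the
    primitive is normalized at 0, and the null sets obtained for the different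
    [n] are put together. *)
Lemma antider_exists h : measurable_fun setT h -> loc_bounded h ->
  exists2 f, antider f h &
    forall s t, s <= t -> \int[mu]_(l in `[s, t]) h l = f t - f s.
Proof.
move=> mh bh.
have ih a b := loc_bounded_integrable a b mh bh.
have [I IE] : exists I : R -> R -> R, forall a b,
    \int[mu]_(l in `[a, b]) h l = I a b by eexists.
have chasles a b c : a <= b -> b <= c -> I a c = I a b + I b c.
  move=> ab bc; rewrite -!IE; have := @Rintegral_itvB R h (BLeft a) (BRight c) b (ih a c).
  rewrite !bnd_simp => /(_ ab bc); rewrite Rintegral_itv_obnd_cbnd.
    by move=> <-; rewrite addrC subrK.
  by apply: integrableS (ih b c) => //; exact: subset_itv_oc_cc.
have int0 a b : b <= a -> I a b = 0.
  rewrite -IE le_eqVlt => /predU1P[->|ba]; first by rewrite set_itv1 Rintegral_set1.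
  by rewrite set_itv_ge ?Rintegral_set0// bnd_simp -ltNge.
(* One of the two integrals vanishes, its interval being empty or a point. *)
pose f t := I 0 t - I t 0.
have fE a t : a <= 0 -> a <= t -> f t = I a t - I a 0.
  move=> a0 at_; rewrite /f; have [t0|t0] := leP 0 t.
    by have := chasles a 0 t a0 t0; have := int0 t 0 t0; lra.
  by have := chasles a t 0 at_ (ltW t0); have := int0 0 t (ltW t0); lra.
have fI s t : s <= t -> \int[mu]_(l in `[s, t]) h l = f t - f s.
  move=> st; have m0 : Num.min s 0 <= 0 by rewrite ge_min lexx orbT.
  have ms : Num.min s 0 <= s by rewrite ge_min lexx.
  rewrite IE (fE (Num.min s 0) t)// ?(le_trans ms)// (fE (Num.min s 0) s)//.
  by rewrite (chasles (Num.min s 0) s t)//; lra.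
exists f => //; split.
  move=> M; have [C hC] := bh M; exists `|C| => //.
  have two s t : s <= t -> `|s| <= M -> `|t| <= M -> `|f s - f t| <= `|C| * `|s - t|.
    move=> st sM tM; rewrite distrC -fI// [`|s - t|]distrC [`|t - s|]ger0_norm ?subr_ge0//.
    apply: le_trans (le_normr_Rintegral _ (ih s t)) _ => //.
    apply: (@le_trans _ _ (\int[mu]_(l in `[s, t]) `|C|)).
      apply: le_Rintegral => //.
      - exact: integrable_norm.
      - apply: (@loc_bounded_integrable (fun=> `|C|)); first exact: measurable_cst.
        by move=> ?; exists `|C| => *; rewrite normr_id.
      - move=> x /=; rewrite in_itv/= => /andP[sx xt].
        apply: le_trans (ler_norm C); apply: hC; move: sM tM; rewrite !ler_norml; lra.
    rewrite Rintegral_cst//= lebesgue_measure_itv/= lte_fin.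
    move: st; rewrite le_eqVlt => /predU1P[->|->] /=; last by [].
    by rewrite ltxx subrr.
  move=> s t sM tM; have [st|/ltW ts] := leP s t; first exact: two.
  by rewrite distrC [X in _ * X]distrC two.
have dfn (n : nat) : {ae mu, forall t : R, - n%:R < t -> is_derive t 1 f (h t)}.
  pose F t := \int[mu]_(l in `[- n%:R, t]) h l.
  have := FTC1 (fun y => ih (- n%:R) y) (loc_bounded_locally_integrable mh bh).
  apply: lebesgue_aeS => t H nt.
  have [dF F't] : derivable F t 1 /\ (F^`()%classic t) = h t.
    by apply: H; rewrite /= lte_fin.
  have FD : is_derive t 1 F (h t).
    by rewrite -F't derive1E; apply/derivableP.
  apply: (@near_eq_is_derive _ _ _ (fun t => F t - F 0)).
  - near=> u.
    have nu : - n%:R <= u by apply/ltW; near: u; exact: lt_nbhsr.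
    by rewrite /F !IE (fE (- n%:R) u)// oppr_le0.
  - by apply: (is_derive_eq (is_deriveB FD (is_derive_cst (F 0) t 1))); rewrite subr0.
have : mu.-negligible (\bigcup_n ~` [set t : R | - n%:R < t -> is_derive t 1 f (h t)]).
  by apply: negligible_bigcup => n; exact: dfn.
apply: negligibleS => t /= nd.
exists (Num.bound `|t|) => //= H; apply: nd; apply: H.
have := archi_boundP (normr_ge0 t); have := ler_norm (- t); rewrite normrN; lra.
Unshelve. all: by end_near. Qed.

Lemma antider_integral f h s t : measurable_fun setT h -> loc_bounded h ->
  antider f h -> s <= t -> \int[mu]_(l in `[s, t]) h l = f t - f s.
Proof.
move=> mh bh fh st; have [g gh ->//] := antider_exists mh bh.
exact: antider_unique gh fh.
Qed.

(** In integrated form the relation passes to pointwise limits by dominated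
    convergence. *)
Lemma antider_cvg (f_ h_ : nat -> R -> R) f h (C : R) :
  (forall n, antider (f_ n) (h_ n)) -> (forall n, measurable_fun setT (h_ n)) ->
  (forall n t, `|h_ n t| <= C) ->
  (forall t, f_ n t @[n --> \oo] --> f t) -> (forall t, h_ n t @[n --> \oo] --> h t) ->
  antider f h.
Proof.
move=> fh mh hC cf ch.
have mh' : measurable_fun setT h by apply: measurable_fun_cvg mh _ => t _; exact: ch.
have hC' t : `|h t| <= C.
  have cn : `|h_ n t| @[n --> \oo] --> `|h t| by apply: cvg_norm; exact: ch.
  by apply: (cvgr_to_le cn); exact: nearW.
have lb k : (forall t, `|k t| <= C) -> loc_bounded k by move=> kC M; exists C.
have [g gh gI] := antider_exists mh' (lb _ hC').
have key s t : s <= t -> f t - f s = g t - g s.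
  move=> st; rewrite -gI//.
  have c1 : f_ n t - f_ n s @[n --> \oo] --> f t - f s by apply: cvgB; exact: cf.
  suff c2 : f_ n t - f_ n s @[n --> \oo] --> \int[mu]_(l in `[s, t]) h l.
    exact: cvg_unique c1 c2.
  have -> : (fun n => f_ n t - f_ n s) = (fun n => \int[mu]_(l in `[s, t]) h_ n l).
    by apply/funext => n; rewrite (antider_integral _ _ (fh n))//; exact: lb.
  have iC : mu.-integrable `[s, t] (EFin \o (fun=> C)).
    by apply: loc_bounded_integrable => // M; exists `|C|.
  have mD : measurable (`[s, t]%classic : set R) by exact: measurable_itv.
  have m1 n : measurable_fun `[s, t] (EFin \o h_ n).
    by apply/measurable_EFinP/measurable_funTS.
  have m2 : measurable_fun `[s, t] (EFin \o h).
    by apply/measurable_EFinP/measurable_funTS.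
  have p1 : {ae mu, forall x, `[s, t]%classic x ->
      (EFin \o h_ n) x @[n --> \oo] --> (EFin \o h) x}.
    by apply: aeW => x _; apply/fine_cvgP; split; [exact: nearW | exact: ch].
  have p2 : {ae mu, forall x n, `[s, t]%classic x ->
      (`|(EFin \o h_ n) x| <= (EFin \o (fun=> C)) x)%E}.
    by apply: aeW => x n _ /=; rewrite lee_fin.
  have [ih _ c3] := @dominated_convergence _ _ _ mu _ mD _ _ _ m1 m2 p1 iC p2.
  apply: fine_cvg; rewrite fineK//; exact: integrable_fin_num.
have fE : f = fun t => g t + (f 0 - g 0).
  apply/funext => t; have [t0|/ltW t0] := leP 0 t.
    by have := key _ _ t0; lra.
  by have := key _ _ t0; lra.
rewrite fE; apply: (antider_eq (antiderD gh (antider_cst (f 0 - g 0)))) => // t.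
by rewrite addr0.
Qed.

(** The almost everywhere part rests on the invariance of the Lebesgue measure
    under [t |-> - t]. *)
Lemma antider_opp_arg f h : antider f h -> antider (fun t => f (- t)) (fun t => - h (- t)).
Proof.
move=> [lf df]; split.
  move=> M; have [L L0 Lf] := lf M; exists L => // s t sM tM.
  have -> : `|s - t| = `|- s - - t| by rewrite -normrN; congr (`| _ |); ring.
  by apply: Lf; rewrite normrN.
have : {ae mu, forall t : R, is_derive (- t) 1 f (h (- t))}.
  have [N [mN N0 sN]] := df.
  exists ((-%R : _ -> measurableTypeR R) @^-1` N); split.
  - by rewrite -[X in measurable X]setTI; exact: oppr_measurable.
  - by have := lebesgue_measureN mN; rewrite /pushforward N0.
  - by move=> t /= nd; apply: sN.
apply: lebesgue_aeS => t dt.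
by apply: (is_derive_eq (is_derive_chain (is_deriveNid t 1) dt)); rewrite mulrN1.
Qed.

End antider_integral.

(** * Scalar linear equations *)

Section linear_equations.
Variable R : realType.
Implicit Types f g h y A alpha : R -> R.

Definition bounded_by_some f : Prop := exists C, forall t, `|f t| <= C.

Lemma bounded_funE f : bounded_fun f <-> bounded_by_some f.
Proof.
split=> [[M [_ MB]]|[C fC]].
  by exists (`|M| + 1) => t; apply: MB => //; have := ler_norm M; lra.
exists C; split; first exact: num_real.
by move=> x Cx t _; apply: le_trans (fC t) (ltW Cx).
Qed.

Definition bounded_measurable f : Prop :=
  measurable_fun setT f /\ bounded_by_some f.

Lemma bounded_loc_bounded f : bounded_by_some f -> loc_bounded f.
Proof. by move=> [C fC] M; exists C. Qed.

Lemma antider_measurable f g : antider f g -> measurable_fun setT f.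
Proof. by move=> [lf _]; apply: continuous_measurable_fun; exact: loc_lipschitz_continuous. Qed.

(** Uniform exponential decay of the solutions [expR \o A] of [y' = A' y], written
    for the logarithm. *)
Definition decaying A : Prop := exists beta k : R,
  0 < beta /\ forall s t, s <= t -> A t - A s <= k - beta * (t - s).

(** Integrating factor: [y * expR (- A)] is nondecreasing. *)
Lemma antider_growth A alpha y g s t : antider A alpha -> antider y g ->
  s <= t -> (forall u, s <= u <= t -> alpha u * y u <= g u) ->
  y s * expR (A t - A s) <= y t.
Proof.
move=> dA dy st H.
have K : y s * expR (- A s) <= y t * expR (- A t).
  apply: (antider_ge0_le (antiderM dy (antider_expR (antiderN dA))) st) => u /H Hu.
  have -> : g u * expR (- A u) + y u * (expR (- A u) * - alpha u) =
    expR (- A u) * (g u - alpha u * y u) by ring.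
  by rewrite mulr_ge0 ?expR_ge0// subr_ge0.
have := ler_wpM2r (expR_ge0 (A t)) K.
by rewrite -!mulrA -!expRD [- A s + _]addrC addNr expR0 mulr1.
Qed.

(** A negative value at [t] would be the image of exponentially larger negative
    values in the past, against the lower bound [- C]. *)
Lemma decaying_ge0 A alpha y g (C : R) : antider A alpha -> decaying A ->
  antider y g -> (forall t, alpha t * y t <= g t) -> (forall t, - C <= y t) ->
  forall t, 0 <= y t.
Proof.
move=> dA [beta [k [beta0 Ak]]] dy yg yC t; rewrite leNgt; apply/negP => yt0.
pose D := `|C| * expR k; have D0 : 0 <= D by rewrite mulr_ge0// expR_ge0.
(* [s] is so far in the past that the bound [- C], propagated from [s] to [t],
   is weaker than [y t] only if [- y t * (1 + x) <= D], while [- y t * x = D]. *)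
pose x := D / - y t; have x0 : 0 <= x by rewrite divr_ge0// oppr_ge0 ltW.
pose s := t - x / beta.
have st : s <= t by rewrite gerBl divr_ge0// ltW.
have := antider_growth dA dy st (fun u _ => yg u).
have e1 : expR (A t - A s) <= expR k * expR (- x).
  rewrite -expRD ler_expR (le_trans (Ak _ _ st))// /s opprB addrCA subrr addr0.
  by rewrite mulrCA divff ?gt_eqF// mulr1.
have e2 : - (D * expR (- x)) <= y s * expR (A t - A s).
  have := yC s; have := ler_norm C => C1 C2.
  have : - `|C| * expR (A t - A s) <= y s * expR (A t - A s).
    by rewrite ler_wpM2r ?expR_ge0//; lra.
  apply: le_trans; rewrite mulNr lerN2 /D -mulrA ler_wpM2l//.
move=> e3.
have e4 : - y t <= D * expR (- x) by lra.
have e5 : - y t * expR x <= D.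
  have := ler_wpM2r (expR_ge0 x) e4.
  by rewrite -[D * _ * _]mulrA -expRD addNr expR0 mulr1.
have e6 : - y t * (1 + x) <= D.
  by apply: le_trans e5; rewrite ler_wpM2l ?expR_ge1Dx//; lra.
have : - y t * x = D by rewrite /x mulrC divfK// oppr_eq0 lt_eqF.
lra.
Qed.

(** The bounded solution is [expR A * (G - G(-oo))] with [G' = expR (- A) * h].
    The increments of [G] from the past to [t] are at most [c * expR (- A t)], so
    that the limit of [G] at minus infinity may be replaced by the supremum of
    [G t - c * expR (- A t)], which lies below all the [G t + c * expR (- A t)]. *)
Lemma bounded_linear_solution A alpha h : antider A alpha -> decaying A ->
  bounded_measurable h ->
  exists2 y, bounded_by_some y & antider y (fun t => alpha t * y t + h t).
Proof.
move=> dA [beta [k [beta0 Ak]]] [mh [C hC]].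
have C0 : 0 <= C by apply: le_trans (hC 0).
pose e t := expR (- A t).
have de : antider e (fun t => e t * - alpha t) by exact/antider_expR/antiderN.
have meh : measurable_fun setT (fun t => e t * h t).
  by apply: measurable_funM => //; exact: antider_measurable de.
have beh : loc_bounded (fun t => e t * h t).
  move=> M; have [D eD] := loc_lipschitz_bounded de.1 M.
  by exists (D * C) => t tM; rewrite normrM; apply: ler_pM => //; exact: eD.
have [G dG _] := antider_exists meh beh.
pose c := C * expR k / beta.
have c0 : 0 <= c by rewrite !mulr_ge0 ?expR_ge0 ?invr_ge0// ltW.
have Gc s t : s <= t -> `|G t - G s| <= c * e t.
  (* [G] is compared with the antiderivative of the exponential bound given by
     the decay of [A]. *)
  move=> st; pose a := beta^-1 * (C * expR k * e t).
  have dE : antider (fun u => a * expR (beta * u + (- (beta * t))))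
      (fun u => a * (expR (beta * u + (- (beta * t))) * beta)).
    exact/antiderZ/antider_expR/antider_lin.
  have bound u : s <= u <= t -> `|e u * h u| <= a * (expR (beta * u + (- (beta * t))) * beta).
    move=> /andP[su ut].
    have -> : a * (expR (beta * u + (- (beta * t))) * beta) =
        expR (k - A t + (beta * u - beta * t)) * C.
      by rewrite /a /e !expRD; field; rewrite gt_eqF.
    rewrite normrM; apply: ler_pM => //.
    by rewrite ger0_norm ?expR_ge0// ler_expR; have := Ak u t ut; lra.
  have a0 : 0 <= a * expR (beta * s + (- (beta * t))).
    by rewrite !mulr_ge0 ?expR_ge0 ?invr_ge0// ltW.
  have -> : c * e t = a * expR (beta * t + (- (beta * t))).
    by rewrite subrr expR0 mulr1 /c /a; field; rewrite gt_eqF.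
  have h1 := antider_le dG dE st (fun u us => le_trans (ler_norm _) (bound u us)).
  have h2 : - G t - - G s <= a * expR (beta * t + (- (beta * t))) -
      a * expR (beta * s + (- (beta * t))).
    apply: (antider_le (antiderN dG) dE st) => u us.
    by apply: le_trans (bound u us); rewrite -normrN ler_norm.
  by rewrite ler_norml; lra.
pose S := [set G t - c * e t | t in setT].
have e0 t : 0 <= e t by exact: expR_ge0.
have cross s t : G s - c * e s <= G t + c * e t.
  have [st|/ltW ts] := leP s t.
    have := Gc s t st; rewrite ler_norml; have := mulr_ge0 c0 (e0 s); lra.
  have := Gc t s ts; rewrite ler_norml; have := mulr_ge0 c0 (e0 t); lra.
have supS : has_sup S.
  split; first by exists (G 0 - c * e 0); exists 0.
  by exists (G 0 + c * e 0) => _ [t _ <-].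
have L1 t : G t - c * e t <= sup S by apply: ub_le_sup; [case: supS | exists t].
have L2 t : sup S <= G t + c * e t.
  by apply: ge_sup; [case: supS | move=> _ [s _ <-]].
have eA t : expR (A t) * e t = 1 by rewrite -expRD subrr expR0.
exists (fun t => expR (A t) * (G t - sup S)).
  exists c => t; rewrite normrM ger0_norm ?expR_ge0//.
  rewrite -[leRHS]mulr1 -(eA t) mulrCA ler_wpM2l ?expR_ge0// ler_norml.
  by have := L1 t; have := L2 t; lra.
apply: (antider_eq (antiderM (antider_expR dA) (antiderB dG (antider_cst (sup S))))) => // t.
by rewrite subr0 mulrA eA mul1r; ring.
Qed.

End linear_equations.

(** * Lower solutions of the Riccati equation *)

Section riccati.
Variable R : realType.
Implicit Types q p x b w : R -> R.

Definition riccati q p (lam : R) x : R -> R :=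
  fun t => - x t ^+ 2 + q t * x t + p t + lam.

(** The form in which bounded solutions are handled, equivalent to
    [bounded_solution] by [bounded_solutionE]. *)
Definition bounded_riccati q p lam b : Prop :=
  antider b (riccati q p lam b) /\ bounded_by_some b.

Definition lower_solution q p lam w : Prop :=
  exists2 g, antider w g & forall t, g t <= riccati q p lam w t.

Lemma bounded_riccati_lower q p lam b :
  bounded_riccati q p lam b -> lower_solution q p lam b.
Proof. by move=> [db _]; exists (riccati q p lam b). Qed.

Lemma riccati_bounded q p lam M : bounded_by_some q -> bounded_by_some p ->
  exists C, forall x t, `|x t| <= M -> `|riccati q p lam x t| <= C.
Proof.
move=> [Cq qC] [Cp pC]; exists (M ^+ 2 + Cq * M + Cp + `|lam|) => x t xM.
rewrite /riccati; do 3 (apply: le_trans (ler_normD _ _) _; apply: lerD) => //.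
  by rewrite normrN normrX ler_pXn2r// ?nnegrE// (le_trans _ xM).
by rewrite normrM ler_pM.
Qed.

Lemma riccati_measurable q p lam x : measurable_fun setT q ->
  measurable_fun setT p -> measurable_fun setT x ->
  measurable_fun setT (riccati q p lam x).
Proof.
move=> mq mp mx; apply: measurable_funD => //; apply: measurable_funD => //.
apply: measurable_funD; last exact: measurable_funM.
by apply: measurableT_comp => //; apply: measurable_funX.
Qed.

Lemma bounded_solutionE q p lam b : bounded_by_some q -> bounded_by_some p ->
  bounded_solution q p lam b <-> bounded_riccati q p lam b.
Proof.
move=> bq bp; split=> [[[acb db] /bounded_funE bb]|[[lb db] bb]].
  split => //; split => //; have [M bM] := bb.
  have [C rC] := riccati_bounded lam M bq bp.
  exact: abs_continuous_loc_lipschitz acb (fun t => rC b t (bM t)) db.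
split; last exact/bounded_funE.
by split => // a c; exact: loc_lipschitz_abs_continuous.
Qed.

Section largest_solution.
Variables (q p : R -> R) (lam M : R).
Hypotheses (bmq : bounded_measurable q) (bmp : bounded_measurable p).
Hypothesis upperM : forall t, - M ^+ 2 + q t * M + p t + lam <= 0.

Let in_strip x := forall t, `|x t| <= M.

(** Monotone iteration from the upper solution [M].  The constant [K] is larger
    than the Lipschitz constant in [x] of the right-hand side on the strip, so
    that [F] is nondecreasing in [x].  Each comparison (the iterates stay below
    [M], stay above the lower solutions, and decrease) says that a bounded
    difference [z] with [z' >= - K z] is nonnegative. *)
Lemma largest_solution_in_strip w0 : lower_solution q p lam w0 -> in_strip w0 ->
  exists a, [/\ bounded_riccati q p lam a, in_strip a &
    forall w, lower_solution q p lam w -> in_strip w -> forall t, w t <= a t].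
Proof.
move=> low0 strip0.
have [mq [Cq qC]] := bmq; have [mp bp] := bmp.
have M0 : 0 <= M by apply: le_trans (strip0 0).
have Cq0 : 0 <= Cq by apply: le_trans (qC 0).
pose K := 2 * M + Cq + 1; have K0 : 0 < K by rewrite /K; lra.
pose F x t := riccati q p lam x t + K * x t.
have F_le x y t : `|x t| <= M -> `|y t| <= M -> x t <= y t -> F x t <= F y t.
  rewrite /F /riccati !ler_norml => /andP[x1 x2] /andP[y1 y2] xy; rewrite -subr_ge0.
  have -> : - y t ^+ 2 + q t * y t + p t + lam + K * y t -
    (- x t ^+ 2 + q t * x t + p t + lam + K * x t) =
    (y t - x t) * (K + q t - (x t + y t)) by ring.
  rewrite mulr_ge0 ?subr_ge0//.
  by have := qC t; rewrite ler_norml /K; lra.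
have dA : antider (fun t => - K * t + 0) (fun=> - K) by exact: antider_lin.
have decA : decaying (fun t => - K * t + 0).
  by exists K, 0; split => // s t st; lra.
pose good x := [/\ measurable_fun setT x, in_strip x &
  forall w, lower_solution q p lam w -> in_strip w -> forall t, w t <= x t].
have [C rC] := riccati_bounded lam M (ex_intro _ Cq qC) bp.
have bmF x : measurable_fun setT x -> in_strip x -> bounded_measurable (F x).
  move=> mx sx; split.
    by apply: measurable_funD; [exact: riccati_measurable | exact: measurable_funM].
  exists (C + K * M) => t; apply: le_trans (ler_normD _ _) _; apply: lerD; first exact: rC.
  by rewrite normrM (gtr0_norm K0) ler_wpM2l// ltW.
have step x : exists y, good x -> antider y (fun t => - K * y t + F x t) /\ good y.
  have [gx|] := pselect (good x); last by exists x.
  have [mx sx wx] := gx.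
  have [y [Cy yC] dy] := bounded_linear_solution dA decA (bmF x mx sx).
  exists y => _; split => //.
  have wy w : lower_solution q p lam w -> in_strip w -> forall t, w t <= y t.
    move=> lw sw t; have [g dw gw] := lw; rewrite -subr_ge0.
    apply: (decaying_ge0 dA decA (antiderB dy dw) _ (C := Cy + M)) => u.
      have := gw u; have := F_le w x u (sw u) (sx u) (wx _ lw sw u).
      by rewrite /F; lra.
    by have := yC u; have := sw u; rewrite !ler_norml; lra.
  have yM t : y t <= M.
    rewrite -subr_ge0.
    apply: (decaying_ge0 dA decA (antiderB (antider_cst M) dy) _ (C := Cy + M)) => u.
      have := F_le x (fun=> M) u (sx u); rewrite ger0_norm// => /(_ (lexx _)).
      have := sx u; rewrite ler_norml => /andP[_ xM] => /(_ xM).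
      by rewrite /F /riccati; have := upperM u; lra.
    by have := yC u; rewrite !ler_norml; lra.
  split => //; first exact: antider_measurable dy.
  move=> t; rewrite ler_norml yM andbT.
  by have := wy _ low0 strip0 t; have := strip0 t; rewrite ler_norml; lra.
have [T HT] := choice step.
pose X n := iter n T (fun=> M).
have goodX n : good (X n).
  elim: n => [|n IH]; last by case: (HT (X n) IH).
  split => //=.
    by move=> t; rewrite ger0_norm.
  by move=> w _ sw t; have := sw t; rewrite ler_norml => /andP[].
have dX n : antider (X n.+1) (fun t => - K * X n.+1 t + F (X n) t).
  by case: (HT (X n) (goodX n)).
have stripX n t : `|X n t| <= M by case: (goodX n).
have decX n t : X n.+1 t <= X n t.
  elim: n t => [|n IH] t.
    by have := stripX 1%N t; rewrite ler_norml => /andP[].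
  rewrite -subr_ge0.
  apply: (decaying_ge0 dA decA (antiderB (dX n) (dX n.+1)) _ (C := M + M)) => u.
    by have := F_le _ _ u (stripX n.+1 u) (stripX n u) (IH u); lra.
  by have := stripX n.+1 u; have := stripX n.+2 u; rewrite !ler_norml; lra.
have cX t : cvgn (fun n => X n t).
  apply: nonincreasing_is_cvgn; first by apply/nonincreasing_seqP => n; exact: decX.
  by exists (- M) => _ [n _ <-]; have := stripX n t; rewrite ler_norml => /andP[].
pose a t := limn (fun n => X n t).
have Xa t : X n t @[n --> \oo] --> a t by exact: cX.
have XSa t : X n.+1 t @[n --> \oo] --> a t by have := Xa t; rewrite -(@cvg_shiftS _ (fun n => X n t)).
have sa : in_strip a.
  move=> t; have cn : `|X n t| @[n --> \oo] --> `|a t| by apply: cvg_norm; exact: Xa.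
  by apply: (cvgr_to_le cn); apply: nearW => n; exact: stripX.
have da : antider a (riccati q p lam a).
  apply: (@antider_cvg _ (fun n => X n.+1) (fun n t => - K * X n.+1 t + F (X n) t)
    _ _ (K * M + (C + K * M))) => //.
  - move=> n; apply: measurable_funD.
      by apply: measurable_funM => //; exact: antider_measurable (dX n).
    by have [mX sX _] := goodX n; case: (bmF _ mX sX).
  - move=> n t; apply: le_trans (ler_normD _ _) _; apply: lerD.
      by rewrite normrM normrN (gtr0_norm K0) ler_wpM2l// ltW.
    apply: le_trans (ler_normD _ _) _; apply: lerD; first exact: rC.
    by rewrite normrM (gtr0_norm K0) ler_wpM2l// ltW.
  - move=> t; have -> : riccati q p lam a t =
        - K * a t + (- (a t * a t) + q t * a t + p t + lam + K * a t).
      by rewrite /riccati; ring.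
    rewrite /F /riccati; under eq_fun do rewrite expr2.
    apply: cvgD; first by apply: cvgM; [exact: cvg_cst | exact: XSa].
    apply: cvgD; last by apply: cvgM; [exact: cvg_cst | exact: Xa].
    do 2 (apply: cvgD; last exact: cvg_cst).
    apply: cvgD; last by apply: cvgM; [exact: cvg_cst | exact: Xa].
    by apply: cvgN; apply: cvgM; exact: Xa.
exists a; split => //; first by split => //; exists M.
move=> w lw sw t; apply: (cvgr_to_ge (Xa t)); apply: nearW => n.
by case: (goodX n) => _ _ /(_ w lw sw t).
Qed.

End largest_solution.
End riccati.

(** * Extremal bounded solutions *)

Section bounded_solutions.
Variable R : realType.
Implicit Types q p b w f : R -> R.

(** The change of unknown [x(t) |-> - x(- t)] maps the equation given by [q], [p]
    to the one given by [reflect q], [time_reversal p]. *)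
Definition reflect f : R -> R := fun t => - f (- t).
Definition time_reversal f : R -> R := fun t => f (- t).

Lemma reflectK : involutive reflect.
Proof. by move=> f; apply/funext => t; rewrite /reflect !opprK. Qed.

Lemma time_reversalK : involutive time_reversal.
Proof. by move=> f; apply/funext => t; rewrite /time_reversal opprK. Qed.

Lemma bounded_measurable_time_reversal f :
  bounded_measurable f -> bounded_measurable (time_reversal f).
Proof.
move=> [mf [C fC]]; split; last by exists C => t; exact: fC.
by apply: (measurableT_comp mf); exact: oppr_measurable.
Qed.

Lemma bounded_measurable_reflect f :
  bounded_measurable f -> bounded_measurable (reflect f).
Proof.
move=> /bounded_measurable_time_reversal[mf [C fC]]; split.
  by apply: measurableT_comp mf; exact: oppr_measurable.
by exists C => t; rewrite normrN; exact: fC.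
Qed.

Lemma bounded_riccati_reflect q p lam b : bounded_riccati q p lam b ->
  bounded_riccati (reflect q) (time_reversal p) lam (reflect b).
Proof.
move=> [db [C bC]]; split; last by exists C => t; rewrite normrN; exact: bC.
apply: (antider_eq (antiderN (antider_opp_arg db))) => // t.
by rewrite /riccati /reflect /time_reversal; ring.
Qed.

Lemma bounded_riccati_reflectE q p lam b : bounded_riccati q p lam b <->
  bounded_riccati (reflect q) (time_reversal p) lam (reflect b).
Proof.
split; first exact: bounded_riccati_reflect.
move=> /bounded_riccati_reflect.
by rewrite !reflectK time_reversalK.
Qed.

(** If [b t0 > M], then [b] stays above [M] on the whole past of [t0], by the
    linear inequality satisfied by [M - b]; there [b' <= - 1], so that [b] is
    unbounded at minus infinity. *)
Lemma bounded_riccati_le q p lam M b : bounded_measurable q ->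
  bounded_riccati q p lam b ->
  (forall t x : R, M <= x -> - x ^+ 2 + q t * x + p t + lam <= - 1) ->
  forall t, b t <= M.
Proof.
move=> [mq [Cq qC]] [db [C bC]] downM t0; rewrite leNgt; apply/negP => Mb.
pose alpha t := - (M + b t) + q t.
have malpha : measurable_fun setT alpha.
  apply: measurable_funD => //; apply: measurableT_comp => //.
  by apply: measurable_funD => //; exact: antider_measurable db.
have balpha : loc_bounded alpha.
  apply: bounded_loc_bounded; exists (`|M| + C + Cq) => t.
  by rewrite (le_trans (ler_normD _ _))// lerD// normrN (le_trans (ler_normD _ _))// lerD.
have [A dA _] := antider_exists malpha balpha.
have above s : s <= t0 -> M < b s.
  move=> st; rewrite -subr_lt0.
  have := antider_growth dA (antiderB (antider_cst M) db) st.
  have H u : s <= u <= t0 -> alpha u * (M - b u) <= 0 - riccati q p lam b u.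
    move=> _; have := downM u M (lexx _); rewrite /alpha /riccati => dM; rewrite -subr_ge0.
    have -> : 0 - (- b u ^+ 2 + q u * b u + p u + lam) - (- (M + b u) + q u) * (M - b u)
      = - (- M ^+ 2 + q u * M + p u + lam) by ring.
    lra.
  move=> /(_ H) K; rewrite -(pmulr_llt0 _ (expR_gt0 (A t0 - A s))).
  by apply: le_lt_trans K _; rewrite subr_lt0.
pose s := t0 - (2 * C + 1).
have C0 : 0 <= C by apply: le_trans (bC 0).
have st : s <= t0 by rewrite /s; lra.
have : b t0 - b s <= (-1 * t0 + 0) - (-1 * s + 0).
  apply: (antider_le db (antider_lin (-1) 0) st) => u /andP[_ ut].
  by apply: downM; exact/ltW/above.
by have := bC s; have := bC t0; rewrite /s !ler_norml; lra.
Qed.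

(** For [x] above this value, [x * (x - Cq) >= Cp + |lam| + 1], so that the
    right-hand side of the equation is at most [- 1]. *)
Definition strip_bound (Cq Cp lam : R) : R := Cq + (Cp + `|lam| + 1).

Lemma riccati_strip q p (Cq Cp lam : R) t x : (forall t, `|q t| <= Cq) ->
  (forall t, `|p t| <= Cp) -> strip_bound Cq Cp lam <= x ->
  - x ^+ 2 + q t * x + p t + lam <= - 1.
Proof.
move=> qC pC; rewrite /strip_bound => Mx.
have Cq0 : 0 <= Cq by apply: le_trans (qC 0).
have Cp0 : 0 <= Cp by apply: le_trans (pC 0).
have l0 := normr_ge0 lam.
have x1 : 1 <= x by lra.
have : q t * x <= Cq * x.
  by rewrite ler_wpM2r//; [lra | apply: le_trans (qC t); exact: ler_norm].
have : p t <= Cp by apply: le_trans (pC t); exact: ler_norm.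
have := ler_norm lam.
have : Cp + `|lam| + 1 <= (x - Cq) * x.
  rewrite -[leLHS]mulr1; apply: ler_pM => //; lra.
by rewrite expr2; lra.
Qed.

Lemma bounded_riccati_strip q p (Cq Cp lam : R) b :
  bounded_measurable q -> bounded_measurable p ->
  (forall t, `|q t| <= Cq) -> (forall t, `|p t| <= Cp) ->
  bounded_riccati q p lam b -> forall t, `|b t| <= strip_bound Cq Cp lam.
Proof.
move=> bq bp qC pC sb t; rewrite ler_norml; apply/andP; split.
  have H := @bounded_riccati_le (reflect q) (time_reversal p) lam
    (strip_bound Cq Cp lam) (reflect b) (bounded_measurable_reflect bq)
    (bounded_riccati_reflect sb).
  have : reflect b (- t) <= strip_bound Cq Cp lam.
    apply: H => u x; apply: riccati_strip => v; last exact: pC.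
    by rewrite /reflect normrN.
  by rewrite /reflect opprK; lra.
by apply: (bounded_riccati_le bq sb) => u x; exact: riccati_strip.
Qed.

(** The strip is chosen to contain [w], with a top beyond which solutions
    decrease, so that its top is an upper solution. *)
Lemma bounded_solution_above q p lam w : bounded_measurable q -> bounded_measurable p ->
  lower_solution q p lam w -> bounded_by_some w ->
  exists2 a, bounded_riccati q p lam a & forall t, w t <= a t.
Proof.
move=> bq bp lw [C wC]; have [mq [Cq qC]] := bq; have [mp [Cp pC]] := bp.
pose M := Num.max C (strip_bound Cq Cp lam).
have upM t : - M ^+ 2 + q t * M + p t + lam <= 0.
  apply: (@le_trans _ _ (-1)); last by rewrite oppr_le0.
  by apply: (riccati_strip t qC pC); rewrite le_max lexx orbT.
have wM t : `|w t| <= M by apply: le_trans (wC t) _; rewrite le_max lexx.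
have [a [sa _ maxa]] := largest_solution_in_strip bq bp upM lw wM.
by exists a => // t; exact: maxa.
Qed.

Lemma maximal_bounded_riccati q p lam : bounded_measurable q -> bounded_measurable p ->
  (exists b, bounded_riccati q p lam b) ->
  exists2 a, bounded_riccati q p lam a &
    forall b, bounded_riccati q p lam b -> forall t, b t <= a t.
Proof.
move=> bq bp [b0 sb0]; have [mq [Cq qC]] := bq; have [mp [Cp pC]] := bp.
have strip b := @bounded_riccati_strip q p Cq Cp lam b bq bp qC pC.
have upM t : - strip_bound Cq Cp lam ^+ 2 + q t * strip_bound Cq Cp lam + p t + lam <= 0.
  by apply: le_trans (riccati_strip t qC pC (lexx _)) _; rewrite oppr_le0.
have [a [sa _ maxa]] :=
  largest_solution_in_strip bq bp upM (bounded_riccati_lower sb0) (strip _ sb0).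
exists a => // b sb t; apply: maxa; first exact: bounded_riccati_lower.
exact: strip.
Qed.

Lemma minimal_bounded_riccati q p lam : bounded_measurable q -> bounded_measurable p ->
  (exists b, bounded_riccati q p lam b) ->
  exists2 r, bounded_riccati q p lam r &
    forall b, bounded_riccati q p lam b -> forall t, r t <= b t.
Proof.
move=> bq bp [b0 sb0].
have [a sa maxa] := maximal_bounded_riccati (bounded_measurable_reflect bq)
  (bounded_measurable_time_reversal bp)
  (ex_intro _ (reflect b0) (bounded_riccati_reflect sb0)).
exists (reflect a); first by apply/bounded_riccati_reflectE; rewrite reflectK.
move=> b /bounded_riccati_reflect /maxa /(_ (- _)) H t.
by have := H t; rewrite /reflect opprK; lra.
Qed.

(** The quotient [rho = (x - x1) / (x2 - x)] satisfies [rho' = (x2 - x1) rho], so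
    that the solution through [(s, x0)] is explicit:
    [x = x2 - (x2 - x1) / (1 + rho)].  It is bounded since [rho >= 0]. *)
Lemma bounded_riccati_between q p (lam : R) (x1 x2 : R -> R) (s x0 : R) :
  bounded_riccati q p lam x1 -> bounded_riccati q p lam x2 ->
  x1 s <= x0 <= x2 s -> exists2 b, bounded_riccati q p lam b & b s = x0.
Proof.
move=> [d1 [C1 b1]] [d2 [C2 b2]] /andP[x10 ].
rewrite le_eqVlt => /predU1P[->|x02]; first by exists x2 => //; split => //; exists C2.
pose d t := x2 t - x1 t.
have dd : antider d (fun t => riccati q p lam x2 t - riccati q p lam x1 t) by exact: antiderB.
have bd t : `|d t| <= C2 + C1.
  by rewrite (le_trans (ler_normD _ _))// normrN lerD.
have [D dD _] := antider_exists (antider_measurable dd)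
  (bounded_loc_bounded (ex_intro _ _ bd)).
pose c := (x0 - x1 s) / (x2 s - x0).
have c0 : 0 <= c by rewrite divr_ge0; lra.
pose rho t := c * expR (D t - D s).
have drho : antider (fun t => rho t + 1) (fun t => c * (expR (D t - D s) * (d t - 0)) + 0).
  by apply/antiderD/antider_cst/antiderZ/antider_expR/antiderB/antider_cst.
have rho1 t : 1 <= rho t + 1 by rewrite lerDr mulr_ge0// expR_ge0.
have dsig := antider_inv rho1 drho.
exists (fun t => x2 t - d t * (rho t + 1)^-1); last first.
  rewrite /rho subrr expR0 mulr1 /c /d; field; apply/andP; split; lra.
split; last first.
  exists (C2 + (C2 + C1) * 1) => t.
  rewrite (le_trans (ler_normD _ _))// normrN lerD// normrM ler_pM//.
  rewrite ger0_norm ?invr_ge0; last by have := rho1 t; lra.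
  by rewrite invf_le1//; have := rho1 t; lra.
apply: (antider_eq (antiderB d2 (antiderM dd dsig))) => // t.
rewrite /riccati /= /d /rho; field.
by have := rho1 t; rewrite /rho; lra.
Qed.

End bounded_solutions.

(** * Variation of the parameter and hyperbolicity *)

Section bifurcation.
Variable R : realType.
Implicit Types q p b w f : R -> R.

Definition solvable q p (lam : R) : Prop := exists b, bounded_riccati q p lam b.

Lemma riccati_shift q p (lam mu : R) b t :
  riccati q p mu b t = riccati q p lam b t + (mu - lam).
Proof. by rewrite /riccati; ring. Qed.

Lemma lower_solutionW q p (lam mu : R) w : lam <= mu ->
  lower_solution q p lam w -> lower_solution q p mu w.
Proof.
move=> lm [g dg gw]; exists g => // t; rewrite (riccati_shift _ _ lam mu).
by rewrite (le_trans (gw t))// lerDl subr_ge0.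
Qed.

Lemma solvableW q p (lam mu : R) : bounded_measurable q -> bounded_measurable p ->
  lam <= mu -> solvable q p lam -> solvable q p mu.
Proof.
move=> bq bp lm [b sb].
have [a sa _] := bounded_solution_above bq bp
  (lower_solutionW lm (bounded_riccati_lower sb)) sb.2.
by exists a.
Qed.

Lemma solvable_reflect q p lam : solvable q p lam ->
  solvable (reflect q) (time_reversal p) lam.
Proof. by move=> [b /bounded_riccati_reflect sb]; exists (reflect b). Qed.

Lemma solvable_reflectE q p lam :
  solvable (reflect q) (time_reversal p) lam <-> solvable q p lam.
Proof.
split; last exact: solvable_reflect.
by move=> /solvable_reflect; rewrite reflectK time_reversalK.
Qed.

Lemma constant_lower_solution q p (Cq Cp lam c : R) :
  (forall t, `|q t| <= Cq) -> (forall t, `|p t| <= Cp) -> 0 <= c ->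
  c ^+ 2 + Cq * c + Cp <= lam -> lower_solution q p lam (fun=> c).
Proof.
move=> qC pC c0 cl; exists (fun=> 0); first exact: antider_cst.
move=> t; rewrite /riccati.
have : - Cq * c <= q t * c.
  by rewrite ler_wpM2r//; have := qC t; rewrite ler_norml => /andP[].
have := pC t; rewrite ler_norml => /andP[]; lra.
Qed.

(** [b + eta] is a lower solution for [lam2] when [eta] is small, by continuity of
    the right-hand side, uniformly in time. *)
Lemma strictly_above q p (lam1 lam2 : R) b : bounded_measurable q ->
  bounded_measurable p -> lam1 < lam2 -> bounded_riccati q p lam1 b ->
  exists2 eta, 0 < eta & exists2 a, bounded_riccati q p lam2 a &
    forall t, b t + eta <= a t.
Proof.
move=> bq bp l12 [db [C bC]]; have [_ [Cq qC]] := bq.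
have C0 : 0 <= C by apply: le_trans (bC 0).
have Cq0 : 0 <= Cq by apply: le_trans (qC 0).
pose D := 2 * C + Cq + 1; have D0 : 0 < D by rewrite /D; lra.
pose eta := Num.min 1 ((lam2 - lam1) / D).
have eta0 : 0 < eta by rewrite lt_min ltr01 divr_gt0// subr_gt0.
have eta1 : eta <= 1 by rewrite ge_min lexx.
have etaD : eta * D <= lam2 - lam1 by rewrite -ler_pdivlMr// ge_min lexx orbT.
have [||a sa ba] := @bounded_solution_above _ q p lam2 (fun t => b t + eta) bq bp.
- exists (riccati q p lam1 b).
    by apply: (antider_eq (antiderD db (antider_cst eta))) => // t; rewrite addr0.
  move=> t; rewrite -subr_ge0.
  have -> : riccati q p lam2 (fun t => b t + eta) t - riccati q p lam1 b t =
    (lam2 - lam1) - eta * (2 * b t - q t + eta) by rewrite /riccati; ring.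
  rewrite subr_ge0; apply: le_trans etaD; rewrite ler_pM2l//.
  by have := bC t; have := qC t; rewrite !ler_norml /D; lra.
- by exists (C + `|eta|) => t; rewrite (le_trans (ler_normD _ _))// lerD.
- by exists eta => //; exists a.
Qed.

(** By concavity in [x] of the right-hand side: at the mean of [b1] and [b2] it
    exceeds the mean of its values by [(b2 - b1) ^+ 2 / 4]. *)
Lemma solvable_of_separated q p (lam delta : R) b1 b2 : bounded_measurable q ->
  bounded_measurable p -> bounded_riccati q p lam b1 -> bounded_riccati q p lam b2 ->
  0 <= delta -> (forall t, delta <= b2 t - b1 t) ->
  solvable q p (lam - delta ^+ 2 / 4).
Proof.
move=> bq bp [d1 [C1 b1C]] [d2 [C2 b2C]] delta0 sep.
have [||a sa _] := @bounded_solution_above _ q p (lam - delta ^+ 2 / 4)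
  (fun t => 2^-1 * (b1 t + b2 t)) bq bp.
- exists (fun t => 2^-1 * (riccati q p lam b1 t + riccati q p lam b2 t)).
    exact/antiderZ/antiderD.
  move=> t; rewrite -subr_ge0.
  have -> : riccati q p (lam - delta ^+ 2 / 4) (fun t => 2^-1 * (b1 t + b2 t)) t -
      2^-1 * (riccati q p lam b1 t + riccati q p lam b2 t) =
      4^-1 * ((b2 t - b1 t) ^+ 2 - delta ^+ 2) by rewrite /riccati; field.
  by rewrite mulr_ge0// subr_ge0 ler_pXn2r// nnegrE (le_trans _ (sep t)).
- exists (2^-1 * (C1 + C2)) => t; rewrite normrM ger0_norm// ler_wpM2l//.
  by rewrite (le_trans (ler_normD _ _))// lerD.
- by exists a.
Qed.

(** Hyperbolicity forward in time.  Hyperbolicity backward in time is the same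
    property of the reflected solution, see [hyperbolicE]. *)
Definition attractive q p (lam : R) b : Prop := bounded_riccati q p lam b /\
  exists2 A, antider A (fun t => - 2 * b t + q t) & decaying A.

Lemma bounded_measurable_linearization q b g : bounded_measurable q ->
  antider b g -> bounded_by_some b -> bounded_measurable (fun t => - 2 * b t + q t).
Proof.
move=> [mq [Cq qC]] db [C bC]; split.
  by apply: measurable_funD => //; apply: measurable_funM => //; exact: antider_measurable db.
exists (2 * C + Cq) => t; rewrite (le_trans (ler_normD _ _))// lerD//.
by rewrite normrM normrN normr_nat ler_pM2l.
Qed.

(** Let [phi' = (- 2 b + q) phi + 1] with [phi] bounded.  For [w = b - eps phi] the
    right-hand side for [lam] exceeds [w'] by [eps - eps ^+ 2 phi ^+ 2], which is
    at least [eps / 2] for [eps] small. *)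
Lemma attractive_solvable q p (lam : R) b : bounded_measurable q ->
  bounded_measurable p -> attractive q p lam b ->
  exists2 eps, 0 < eps & solvable q p (lam - eps).
Proof.
move=> bq bp [[db [C bC]] [A dA decA]].
have bm1 : bounded_measurable (fun _ : R => 1 : R) by split => //; exists `|1|.
have [phi [D phiD] dphi] := bounded_linear_solution dA decA bm1.
pose eps := (2 * (D ^+ 2 + 1))^-1.
have D2 : 0 < D ^+ 2 + 1 by rewrite ltr_wpDl ?sqr_ge0.
have eps0 : 0 < eps by rewrite invr_gt0 mulr_gt0.
exists (eps / 2); first by rewrite divr_gt0.
have [||a sa _] := @bounded_solution_above _ q p (lam - eps / 2)
  (fun t => b t - eps * phi t) bq bp.
- exists (fun t => riccati q p lam b t - eps * ((- 2 * b t + q t) * phi t + 1)).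
    exact/antiderB/antiderZ.
  move=> t; rewrite -subr_ge0.
  have -> : riccati q p (lam - eps / 2) (fun t => b t - eps * phi t) t -
      (riccati q p lam b t - eps * ((- 2 * b t + q t) * phi t + 1)) =
      eps * (2^-1 - eps * phi t ^+ 2) by rewrite /riccati; field.
  rewrite mulr_ge0 ?subr_ge0//; first exact: ltW.
  apply: (@le_trans _ _ (eps * (D ^+ 2 + 1))).
    rewrite ler_pM2l// (@le_trans _ _ (D ^+ 2))// ?lerDl//.
    rewrite -real_normK ?num_real// ler_pXn2r// nnegrE//.
    exact: le_trans (phiD t).
  by rewrite /eps invfM -mulrA mulVf ?mulr1// gt_eqF.
- exists (C + eps * D) => t; rewrite (le_trans (ler_normD _ _))// normrN lerD//.
  by rewrite normrM gtr0_norm// ler_pM2l.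
- by exists a.
Qed.

(** The difference [z = b - c] satisfies [z' = (- 2 b + q) z + z ^+ 2]. *)
Lemma attractive_maximal q p (lam : R) b c : attractive q p lam b ->
  bounded_riccati q p lam c -> forall t, c t <= b t.
Proof.
move=> [[db [C bC]] [A dA decA]] [dc [D cD]] t; rewrite -subr_ge0.
apply: (decaying_ge0 dA decA (antiderB db dc) _ (C := C + D)) => u.
  rewrite -subr_ge0.
  have -> : riccati q p lam b u - riccati q p lam c u - (- 2 * b u + q u) * (b u - c u) =
    (b u - c u) ^+ 2 by rewrite /riccati; ring.
  exact: sqr_ge0.
by have := bC u; have := cD u; rewrite !ler_norml; lra.
Qed.

(** For [d = b2 - b1] one has [d' = (- 2 b2 + q + d) d], and [d >= delta]: the
    exponential of the integral of [- 2 b2 + q + delta] is at most the quotient of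
    two values of [d], hence at most [(C1 + C2) / delta]. *)
Lemma separated_attractive q p (lam delta : R) b1 b2 : bounded_measurable q ->
  bounded_riccati q p lam b1 -> bounded_riccati q p lam b2 ->
  0 < delta -> (forall t, delta <= b2 t - b1 t) -> attractive q p lam b2.
Proof.
move=> bq [d1 [C1 b1C]] [d2 [C2 b2C]] delta0 sep.
split; first by split => //; exists C2.
have [malpha balpha] := bounded_measurable_linearization bq d2 (ex_intro _ C2 b2C).
have [A dA _] := antider_exists malpha (bounded_loc_bounded balpha).
exists A => //; exists delta, (ln ((C1 + C2) / delta)); split => // s t st.
have D0 : 0 < C1 + C2.
  have := sep 0; have := b1C 0; have := b2C 0; rewrite !ler_norml; lra.
have := antider_growth (antiderD dA (antider_lin delta 0)) (antiderB d2 d1) st.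
have H u : s <= u <= t -> (- 2 * b2 u + q u + delta) * (b2 u - b1 u) <=
    riccati q p lam b2 u - riccati q p lam b1 u.
  move=> _; rewrite -subr_ge0.
  have -> : riccati q p lam b2 u - riccati q p lam b1 u -
     (- 2 * b2 u + q u + delta) * (b2 u - b1 u) =
     (b2 u - b1 u - delta) * (b2 u - b1 u) by rewrite /riccati; ring.
  by have := sep u => su; rewrite mulr_ge0; lra.
move=> /(_ H) K.
have E : expR (A t + (delta * t + 0) - (A s + (delta * s + 0))) <= (C1 + C2) / delta.
  rewrite ler_pdivlMr// mulrC.
  apply: le_trans (le_trans K _).
    by rewrite ler_wpM2r ?expR_ge0// sep.
  by have := b1C t; have := b2C t; rewrite !ler_norml; lra.
have : A t + (delta * t + 0) - (A s + (delta * s + 0)) <= ln ((C1 + C2) / delta).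
  by rewrite -[leLHS]expRK ler_ln// posrE ?expR_gt0// divr_gt0.
lra.
Qed.

(** An antiderivative [A] of [- 2 b + q] turns the two integral estimates into
    [decaying A] and [decaying (A \o -%R)], the constants being exchanged by the
    logarithm. *)
Lemma hyperbolicE q p (lam : R) b : bounded_measurable q -> bounded_measurable p ->
  hyperbolic q p lam b <-> attractive q p lam b \/
    attractive (reflect q) (time_reversal p) lam (reflect b).
Proof.
move=> bmq [_ bp]; have bq := bmq.2.
suff main : bounded_riccati q p lam b ->
  (exists k beta : R, [/\ 1 <= k, 0 < beta &
    (forall s t : R, s <= t ->
       expR (oriented_integral s t (fun l => - 2 * b l + q l))
         <= k * expR (- beta * (t - s))) \/
    (forall s t : R, t <= s ->
       expR (oriented_integral s t (fun l => - 2 * b l + q l))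
         <= k * expR (beta * (t - s)))]) <->
  (exists2 A, antider A (fun t => - 2 * b t + q t) & decaying A) \/
  (exists2 A, antider A (fun t => - 2 * reflect b t + reflect q t) & decaying A).
  split=> [[/(bounded_solutionE _ _ bq bp) sb /(main sb) [H|H]]|[[sb H]|[sb' H]]].
  - by left.
  - by right; split => //; exact: bounded_riccati_reflect.
  - by split; [apply/bounded_solutionE | apply/main => //; left].
  - have sb := (bounded_riccati_reflectE q p lam b).2 sb'.
    by split; [apply/bounded_solutionE | apply/main => //; right].
move=> [db [C bC]].
pose alpha t := - 2 * b t + q t.
have [malpha balpha] := bounded_measurable_linearization bmq db (ex_intro _ C bC).
have [A dA AI] := antider_exists malpha (bounded_loc_bounded balpha).
have OI s t : oriented_integral s t alpha = A t - A s.
  rewrite /oriented_integral; have [st|/ltW ts] := leP s t; first by rewrite AI.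
  by rewrite AI// opprB.
have drA : antider (fun t => A (- t)) (fun t => - 2 * reflect b t + reflect q t).
  apply: (antider_eq (antider_opp_arg dA)) => // t.
  by rewrite /alpha /reflect; ring.
have log_bound (k u v : R) : 1 <= k -> expR u <= k * expR v -> u <= ln k + v.
  move=> k1 H; have k0 : 0 < k by lra.
  by rewrite -ler_expR expRD lnK.
have exp_bound (k u v : R) : u <= k + v -> expR u <= expR `|k| * expR v.
  by move=> H; rewrite -expRD ler_expR (le_trans H)// lerD2r ler_norm.
have k1 (k : R) : 1 <= expR `|k| by rewrite -expR0 ler_expR.
split=> [[k [beta [k1' beta0 [H|H]]]]|[[B dB [beta [k [beta0 H]]]]|[B dB [beta [k [beta0 H]]]]]].
- left; exists A => //; exists beta, (ln k); split => // s t st.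
  by have := log_bound _ _ _ k1' (H s t st); rewrite OI; lra.
- right; exists (fun t => A (- t)) => //; exists beta, (ln k); split => // s t st.
  have ts : - t <= - s by rewrite lerN2.
  by have := log_bound _ _ _ k1' (H (- s) (- t) ts); rewrite OI; lra.
- exists (expR `|k|), beta; split => //; left => s t st.
  rewrite OI (antider_unique s t dA dB); apply: exp_bound.
  by have := H s t st; lra.
- exists (expR `|k|), beta; split => //; right => s t ts.
  have st : - s <= - t by rewrite lerN2.
  have := antider_unique (- s) (- t) drA dB; rewrite !opprK => E.
  rewrite OI E; apply: exp_bound.
  by have := H _ _ st; lra.
Qed.

End bifurcation.

(** * Measurability of BPUC functions *)

Section bpuc.
Variable R : realType.
Implicit Types f : R -> R.

Lemma floor_step_measurable (g : int -> R) (c : R) : 0 < c ->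
  measurable_fun setT (fun t : R => g (Num.floor (t * c))).
Proof.
move=> c0 _ Y mY; rewrite setTI.
have -> : (fun t : R => g (Num.floor (t * c))) @^-1` Y =
    \bigcup_(k : int) [set t : R | k%:~R / c <= t < (k + 1)%:~R / c /\ Y (g k)].
  apply/seteqP; split => [t /= Yt|t [k _ [/= kt Yk]]].
    exists (Num.floor (t * c)) => //=; split => //.
    by rewrite ler_pdivrMr// ltr_pdivlMr// floor_itv.
  rewrite (@floor_def _ _ k)//.
  by move: kt; rewrite ler_pdivrMr// ltr_pdivlMr.
apply: countable_bigcupT_measurable => [|k]; first exact: countableP.
have [Yk|nYk] := pselect (Y (g k)).
  rewrite (_ : [set _ | _] = `[k%:~R / c, (k + 1)%:~R / c[%classic)//.
  by apply/seteqP; split => t /=; rewrite in_itv/= => // -[].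
rewrite (_ : [set _ | _] = set0)//.
by apply/seteqP; split => t //= -[].
Qed.

(** [f t] is the limit of the values of [f] at the next point of the grid of step
    [1 / (n + 1)], strictly to the right of [t]; as functions of [t] these are step
    functions. *)
Lemma right_continuous_measurable f :
  (forall t : R, f x @[x --> t^'+] --> f t) -> measurable_fun setT f.
Proof.
move=> rcf.
pose u (n : nat) (t : R) := (Num.floor (t * n.+1%:R) + 1)%:~R / n.+1%:R : R.
apply: (@measurable_fun_cvg _ _ _ _ (fun n t => f (u n t))) => [n|t _].
  exact: (floor_step_measurable (fun k => f ((k + 1)%:~R / n.+1%:R))).
have ut n : t < u n t by rewrite /u ltr_pdivlMr// floorD1_gt.
have ut' n : u n t <= t + n.+1%:R^-1.
  rewrite /u ler_pdivrMr// mulrDl mulVf// intrD lerD2r.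
  by have /andP[] := floor_itv (t * n.+1%:R : R).
apply: (cvg_at_rightP f t (f t)).1 (rcf t) _ _; split => //.
apply: (@squeeze_cvgr _ _ _ _ (fun=> t) (fun n => t + n.+1%:R^-1)).
- by apply: nearW => n; rewrite ltW//=.
- exact: cvg_cst.
- by rewrite -[X in _ --> X]addr0; apply: cvgD; [exact: cvg_cst | exact: cvg_harmonic].
Qed.

Lemma BPUC_bounded_measurable f : BPUC f -> bounded_measurable f.
Proof.
move=> [n [Delta [qs [H ->]]]].
have bq i : exists C, forall t, `|qs i t| <= C.
  by have [_ [/bounded_funE]] := H i.
have [C qC] := choice bq.
split; last first.
  exists (\sum_(i < n) C i) => t; rewrite (le_trans (ler_norm_sum _ _ _))//.
  by apply: ler_sum => i _.
apply: measurable_sum => i; apply: right_continuous_measurable.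
by have [_ []] := H i.
Qed.

End bpuc.

(** * The bifurcation value *)

Section bifurcation_value.
Variable R : realType.
Implicit Types q p b w f : R -> R.

Lemma le_sup_norm f t : bounded_by_some f -> `|f t| <= sup_norm f.
Proof.
move=> [C fC]; apply: ub_le_sup; last by exists t.
by exists C => _ [s _ <-].
Qed.

Lemma bounded_by_some_discriminant q p : bounded_by_some q -> bounded_by_some p ->
  bounded_by_some (fun t => q t ^+ 2 / 4 + p t).
Proof.
move=> [Cq qC] [Cp pC]; exists (Cq ^+ 2 / 4 + Cp) => t.
rewrite (le_trans (ler_normD _ _))// lerD// normrM ler_pM//.
  by rewrite normrX ler_pXn2r// nnegrE// (le_trans _ (qC t)).
by rewrite ger0_norm.
Qed.

(** Completing the square, [b' <= q ^+ 2 / 4 + p + lam], which is negative and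
    bounded away from 0 for smaller parameters: [b] could not be bounded. *)
Lemma solvable_ge q p (lam : R) : bounded_by_some q -> bounded_by_some p ->
  solvable q p lam -> - sup_norm (fun t => q t ^+ 2 / 4 + p t) <= lam.
Proof.
move=> bq bp [b [db [C bC]]]; rewrite leNgt; apply/negP => lamN.
have Nle t := le_sup_norm t (bounded_by_some_discriminant bq bp).
set N := sup_norm _ in lamN Nle.
have [c cE] : exists c, c = - (lam + N) by eexists.
have c0 : 0 < c by lra.
have C0 : 0 <= C by apply: le_trans (bC 0).
have T0 : 0 <= (2 * C + 1) / c by rewrite divr_ge0//; lra.
(* The time at which a decrease of speed [c] leaves the strip [|b| <= C]. *)
have : b ((2 * C + 1) / c) - b 0 <= - c * ((2 * C + 1) / c) + 0 - (- c * 0 + 0).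
  apply: (antider_le db (antider_lin (- c) 0) T0) => u _; rewrite /riccati.
  have -> : - b u ^+ 2 + q u * b u + p u + lam =
    - (b u - q u / 2) ^+ 2 + (q u ^+ 2 / 4 + p u) + lam by field.
  have := sqr_ge0 (b u - q u / 2); have := le_trans (ler_norm _) (Nle u).
  by lra.
have -> : - c * ((2 * C + 1) / c) + 0 - (- c * 0 + 0) = - (2 * C + 1).
  by field; rewrite gt_eqF.
by have := bC 0; have := bC ((2 * C + 1) / c); rewrite !ler_norml; lra.
Qed.

Lemma solvable_sup_norm q p : bounded_measurable q -> bounded_measurable p ->
  solvable q p (sup_norm p).
Proof.
move=> bq bp; have [_ [Cq qC]] := bq.
have low : lower_solution q p (sup_norm p) (fun=> 0).
  apply: (constant_lower_solution qC (fun t => le_sup_norm t bp.2)) => //.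
  by rewrite expr0n/= mulr0 !add0r.
have [|a sa _] := bounded_solution_above bq bp low; last by exists a.
by exists 0 => _; rewrite normr0.
Qed.

(** The maximal solutions for [l + 1 / (n + 1)] decrease with [n] and stay in a
    common strip; their limit is a solution for [l]. *)
Lemma solvable_closed q p (l : R) : bounded_measurable q -> bounded_measurable p ->
  (forall lam, l < lam -> solvable q p lam) -> solvable q p l.
Proof.
move=> bq bp sl.
have [mq [Cq qC]] := bq; have [mp [Cp pC]] := bp.
pose ln (n : nat) := l + n.+1%:R^-1.
have lln n : l < ln n by rewrite /ln ltrDl invr_gt0.
have ex n : exists a, bounded_riccati q p (ln n) a /\
    forall b, bounded_riccati q p (ln n) b -> forall t, b t <= a t.
  by have [a sa ma] := maximal_bounded_riccati bq bp (sl _ (lln n)); exists a.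
have [a Ha] := choice ex.
have aS n t : a n.+1 t <= a n t.
  have lS : ln n.+1 <= ln n by rewrite /ln lerD2l lef_pV2 ?posrE// ler_nat.
  have [b sb ab] := bounded_solution_above bq bp (lower_solutionW lS
     (bounded_riccati_lower (Ha n.+1).1)) (Ha n.+1).1.2.
  exact: le_trans (ab t) ((Ha n).2 b sb t).
pose M := Cq + (Cp + (`|l| + 1) + 1).
have inv1 n : n.+1%:R^-1 <= 1 :> R by rewrite invf_le1// ler1n.
have aM n t : `|a n t| <= M.
  apply: le_trans (bounded_riccati_strip bq bp qC pC (Ha n).1 t) _.
  rewrite /strip_bound /M; do 3 (rewrite ?lerD2l ?lerD2r).
  by rewrite (le_trans (ler_normD _ _))// lerD2l ger0_norm// invr_ge0.
have ca t : cvgn (fun n => a n t).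
  apply: nonincreasing_is_cvgn; first by apply/nonincreasing_seqP => n; exact: aS.
  by exists (- M) => _ [n _ <-]; have := aM n t; rewrite ler_norml => /andP[].
pose b t := limn (fun n => a n t).
have ab t : a n t @[n --> \oo] --> b t by exact: ca.
have [C rC] := riccati_bounded l M bq.2 bp.2.
exists b; split; last first.
  exists M => t; have cn : `|a n t| @[n --> \oo] --> `|b t| by apply: cvg_norm; exact: ab.
  by apply: (cvgr_to_le cn); apply: nearW => n; exact: aM.
apply: (@antider_cvg _ a (fun n => riccati q p (ln n) (a n)) _ _ (C + 1)) => //.
- by move=> n; exact: (Ha n).1.1.
- by move=> n; apply: riccati_measurable => //; exact: antider_measurable (Ha n).1.1.
- move=> n t; rewrite (riccati_shift q p l) (le_trans (ler_normD _ _))// lerD ?rC//.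
  by rewrite /ln addrC addKr ger0_norm ?invr_ge0.
- move=> t; have -> : riccati q p l b t = - (b t * b t) + q t * b t + p t + (l + 0).
    by rewrite /riccati; ring.
  rewrite /riccati; under eq_fun do rewrite expr2.
  apply: cvgD; last by apply: cvgD; [exact: cvg_cst | exact: cvg_harmonic].
  apply: cvgD; last exact: cvg_cst.
  apply: cvgD; last by apply: cvgM; [exact: cvg_cst | exact: ab].
  by apply: cvgN; apply: cvgM; exact: ab.
Qed.

End bifurcation_value.

Section extremal_solutions.
Variables (R : realType) (q p : R -> R).
Hypotheses (bq : bounded_measurable q) (bp : bounded_measurable p).
Implicit Types lam : R.

Let solutionE lam b := bounded_solutionE lam b bq.2 bp.2.

Lemma bounded_pairs_neq0 lam : bounded_pairs q p lam !=set0 <-> solvable q p lam.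
Proof.
split=> [[sx [b /solutionE sb _]]|[b /solutionE sb]]; first by exists b.
by exists (0, b 0), b.
Qed.

Lemma a_solP lam : solvable q p lam -> maximal_bounded_solution q p lam (a_sol q p lam).
Proof.
move=> /(maximal_bounded_riccati bq bp)[a sa ma].
apply: (@xgetPex _ (cst 0) [set a | maximal_bounded_solution q p lam a]).
exists a; split; first exact/solutionE.
by move=> b /solutionE; exact: ma.
Qed.

Lemma r_solP lam : solvable q p lam -> minimal_bounded_solution q p lam (r_sol q p lam).
Proof.
move=> /(minimal_bounded_riccati bq bp)[r sr mr].
apply: (@xgetPex _ (cst 0) [set r | minimal_bounded_solution q p lam r]).
exists r; split; first exact/solutionE.
by move=> b /solutionE; exact: mr.
Qed.

Lemma a_sol_riccati lam : solvable q p lam -> bounded_riccati q p lam (a_sol q p lam).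
Proof. by move=> /a_solP[/solutionE]. Qed.

Lemma r_sol_riccati lam : solvable q p lam -> bounded_riccati q p lam (r_sol q p lam).
Proof. by move=> /r_solP[/solutionE]. Qed.

Lemma le_a_sol lam b : bounded_riccati q p lam b -> forall t, b t <= a_sol q p lam t.
Proof.
move=> sb; have sol : solvable q p lam by exists b.
by have [_ H] := a_solP sol; apply: H; exact/solutionE.
Qed.

Lemma ge_r_sol lam b : bounded_riccati q p lam b -> forall t, r_sol q p lam t <= b t.
Proof.
move=> sb; have sol : solvable q p lam by exists b.
by have [_ H] := r_solP sol; apply: H; exact/solutionE.
Qed.

Lemma bounded_pairsE lam : solvable q p lam -> bounded_pairs q p lam =
  [set sx : R * R | r_sol q p lam sx.1 <= sx.2 <= a_sol q p lam sx.1].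
Proof.
move=> sol; apply/seteqP; split => [[s x0] [b /solutionE sb /= <-]|[s x0] /= rxa].
  by rewrite le_a_sol// ge_r_sol.
have [b sb bs] := bounded_riccati_between (r_sol_riccati sol) (a_sol_riccati sol) rxa.
by exists b => //; exact/solutionE.
Qed.

Lemma a_sol_lt lam1 lam2 : lam1 < lam2 -> solvable q p lam1 ->
  exists2 eta, 0 < eta & forall t, a_sol q p lam1 t + eta <= a_sol q p lam2 t.
Proof.
move=> l12 /a_sol_riccati sa.
have [eta eta0 [b sb ab]] := strictly_above bq bp l12 sa.
by exists eta => // t; rewrite (le_trans (ab t))// le_a_sol.
Qed.

Lemma a_sol_infty (M : R) : \forall lam \near +oo, forall t, M < a_sol q p lam t.
Proof.
have [mq [Cq qC]] := bq; have [mp [Cp pC]] := bp.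
pose c := `|M| + 1; have c0 : 0 <= c by rewrite addr_ge0.
exists (c ^+ 2 + Cq * c + Cp); split; first exact: num_real.
move=> lam cl t.
have low := constant_lower_solution qC pC c0 (ltW cl).
have [|a sa ca] := bounded_solution_above bq bp low.
  by exists `|c| => _.
have := ler_norm M; have := ca t; have := le_a_sol sa t; rewrite /c; lra.
Qed.

End extremal_solutions.

Section bifurcation_properties.
Variable R : realType.
Implicit Types (q p : R -> R) (lam : R).

Lemma r_sol_reflect q p lam : bounded_measurable q -> bounded_measurable p ->
  solvable q p lam ->
  reflect (r_sol q p lam) = a_sol (reflect q) (time_reversal p) lam.
Proof.
move=> bq bp sol.
have bq' := bounded_measurable_reflect bq.
have bp' := bounded_measurable_time_reversal bp.
have sol' := solvable_reflect sol.
apply/funext => t; apply/le_anti/andP; split.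
  by apply: le_a_sol => //; exact/bounded_riccati_reflect/r_sol_riccati.
have sa := (a_sol_riccati bq' bp' sol').
have : bounded_riccati q p lam (reflect (a_sol (reflect q) (time_reversal p) lam)).
  by apply/bounded_riccati_reflectE; rewrite reflectK.
move=> /(ge_r_sol bq bp)/(_ (- t)); rewrite /reflect opprK; lra.
Qed.

Lemma r_sol_lt q p lam1 lam2 : bounded_measurable q -> bounded_measurable p ->
  lam1 < lam2 -> solvable q p lam1 ->
  exists2 eta, 0 < eta & forall t, r_sol q p lam2 t + eta <= r_sol q p lam1 t.
Proof.
move=> bq bp l12 sol1; have sol2 := solvableW bq bp (ltW l12) sol1.
have [eta eta0 H] := a_sol_lt (bounded_measurable_reflect bq)
  (bounded_measurable_time_reversal bp) l12 (solvable_reflect sol1).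
exists eta => // t; have := H (- t).
by rewrite -!r_sol_reflect// /reflect opprK; lra.
Qed.

(** The infimum of the parameters with a bounded solution. *)
Lemma is_lambda_star_exists q p : bounded_measurable q -> bounded_measurable p ->
  exists l, is_lambda_star q p l.
Proof.
move=> bq bp.
pose S := [set lam | solvable q p lam].
have Sp : S (sup_norm p) by exact: solvable_sup_norm.
have infS : has_inf S.
  split; first by exists (sup_norm p).
  exists (- sup_norm (fun t => q t ^+ 2 / 4 + p t)) => lam Slam.
  exact: solvable_ge bq.2 bp.2 Slam.
pose l := inf S.
have soll : solvable q p l.
  apply: solvable_closed => // lam llam.
  have e0 : 0 < lam - l by rewrite subr_gt0.
  have [mu Smu] := inf_adherent e0 infS.
  by rewrite addrC subrK => /ltW ml; exact: solvableW Smu.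
have solE lam : solvable q p lam <-> l <= lam.
  split=> [sol|ll]; first by apply: ge_inf => //; case: infS.
  exact: solvableW soll.
exists l.
have ra lam t : solvable q p lam -> r_sol q p lam t <= a_sol q p lam t.
  by move=> sol; apply: le_a_sol => //; exact: r_sol_riccati.
have sol_refl lam : solvable (reflect q) (time_reversal p) lam <-> l <= lam.
  by rewrite solvable_reflectE.
have gap_lb lam : l <= lam -> has_lbound (range (fun t => a_sol q p lam t - r_sol q p lam t)).
  move=> ll; exists 0 => _ [t _ <-]; rewrite subr_ge0 ra//; exact/solE.
have gap_ne lam : range (fun t => a_sol q p lam t - r_sol q p lam t) !=set0.
  by exists (a_sol q p lam 0 - r_sol q p lam 0), 0.
split.
- by rewrite (solvable_ge bq.2 bp.2 soll)/=; exact/solE.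
- move=> lam; rewrite ltNge; split=> [B0|/negP nl].
    apply/negP => /solE/(bounded_pairs_neq0 bq bp); by rewrite B0 => -[].
  apply/eqP/negPn/negP => /set0P/(bounded_pairs_neq0 bq bp)/solE; exact: nl.
- split; last 2 first.
  + exact: a_sol_infty.
  + move=> M; have := a_sol_infty (bounded_measurable_reflect bq)
      (bounded_measurable_time_reversal bp) (- M).
    apply: filterS2 (nbhs_pinfty_ge (num_real l)) => lam ll H t.
    have := H (- t); rewrite -r_sol_reflect//; last exact/solE.
    by rewrite /reflect opprK; lra.
  + move=> lam1 lam2 ll1 l12.
    have sol1 : solvable q p lam1 by exact/solE.
    have sol2 : solvable q p lam2 by exact/solE/(le_trans ll1)/ltW.
    have [eta eta0 aeta] := a_sol_lt bq bp l12 sol1.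
    have [zeta zeta0 rzeta] := r_sol_lt bq bp l12 sol1.
    have tri t : [/\ r_sol q p lam2 t < r_sol q p lam1 t,
        r_sol q p lam1 t <= a_sol q p lam1 t & a_sol q p lam1 t < a_sol q p lam2 t].
      by split; [have := rzeta t; lra | exact: ra | have := aeta t; lra].
    split => //; rewrite !bounded_pairsE//; split.
      move=> [s x0] /= /andP[rx xa]; have [h1 h2 h3] := tri s.
      by apply/andP; split; lra.
    move=> /(_ (0, a_sol q p lam2 0)) /= H.
    have [h1 h2 h3] := tri 0.
    by have := H ltac:(apply/andP; split; lra) => /andP[]; lra.
- split.
    apply/eqP; rewrite eq_le; apply/andP; split; last first.
      by apply: lb_le_inf => // _ [t _ <-]; rewrite subr_ge0 ra.
    rewrite leNgt; apply/negP; set delta := inf _ => delta0.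
    have sep t : delta <= a_sol q p l t - r_sol q p l t.
      by apply: ge_inf; [exact: gap_lb | exists t].
    have := solvable_of_separated bq bp (r_sol_riccati bq bp soll)
      (a_sol_riccati bq bp soll) (ltW delta0) sep.
    move=> /solE; have : 0 < delta ^+ 2 by rewrite exprn_gt0.
    lra.
  move=> [b /(hyperbolicE _ _ bq bp) [H|H]].
    by have [eps eps0 /solE] := attractive_solvable bq bp H; lra.
  have [eps eps0 /sol_refl] := attractive_solvable (bounded_measurable_reflect bq)
    (bounded_measurable_time_reversal bp) H.
  lra.
- move=> lam llam.
  have sol : solvable q p lam by exact/solE/ltW.
  have [eta eta0 aeta] := a_sol_lt bq bp llam soll.
  have sr := r_sol_riccati bq bp sol; have sa := a_sol_riccati bq bp sol.
  have sep t : eta <= a_sol q p lam t - r_sol q p lam t.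
    have [zeta zeta0 rzeta] := r_sol_lt bq bp llam soll.
    by have := rzeta t; have := aeta t; have := ra l t soll; lra.
  split.
    apply: (lt_le_trans eta0); apply: lb_le_inf => // _ [t _ <-]; exact: sep.
  move=> b; rewrite hyperbolicE//; split=> [[H|H]|[->|->]].
  + left; apply/funext => t; apply/le_anti/andP; split; first exact: le_a_sol H.1 t.
    exact: attractive_maximal H sa t.
  + right; apply: (can_inj (@reflectK R)); rewrite r_sol_reflect//.
    apply/funext => t; apply/le_anti/andP; split.
      by apply: le_a_sol H.1 t; [exact: bounded_measurable_reflect | exact: bounded_measurable_time_reversal].
    apply: attractive_maximal H _ t; rewrite -r_sol_reflect//.
    exact: bounded_riccati_reflect.
  + by left; exact: separated_attractive bq sr sa eta0 sep.
  + right; apply: (separated_attractive (bounded_measurable_reflect bq)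
      (bounded_riccati_reflect sa) (bounded_riccati_reflect sr) eta0) => t.
    by have := sep (- t); rewrite /reflect; lra.
Qed.

Lemma is_lambda_star_unique q p l l' :
  is_lambda_star q p l -> is_lambda_star q p l' -> l = l'.
Proof.
move=> [_ H _ _ _] [_ H' _ _ _]; apply/le_anti.
have key x y : (forall lam, bounded_pairs q p lam = set0 <-> lam < x) ->
    (forall lam, bounded_pairs q p lam = set0 <-> lam < y) -> x <= y.
  by move=> Hx Hy; rewrite leNgt; apply/negP => /Hx/Hy; rewrite ltxx.
by rewrite !key.
Qed.

End bifurcation_properties.

Theorem theorem2p11 (R : realType) (q p : R -> R) (hq : BPUC q) (hp : BPUC p) :
  (forall lam, bounded_pairs q p lam !=set0 ->
     [/\ maximal_bounded_solution q p lam (a_sol q p lam),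
         minimal_bounded_solution q p lam (r_sol q p lam) &
         bounded_pairs q p lam =
           [set sx : R * R | r_sol q p lam sx.1 <= sx.2 <= a_sol q p lam sx.1]]) /\
  exists! l : R,
    is_lambda_star q p l /\
    forall mu l' : R,
      is_lambda_star q (fun t => p t + mu) l' <-> l' = l - mu.
Proof.
have bq := BPUC_bounded_measurable hq; have bp := BPUC_bounded_measurable hp.
split.
  move=> lam /(bounded_pairs_neq0 bq bp) sol.
  by split; [exact: a_solP | exact: r_solP | exact: bounded_pairsE].
have [l Hl] := is_lambda_star_exists bq bp.
exists l; split; last by move=> l' [Hl' _]; exact: is_lambda_star_unique Hl Hl'.
split=> // mu.
have bpmu : bounded_measurable (fun t => p t + mu).
  have [mp [Cp pC]] := bp; split; first exact: measurable_funD.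
  by exists (Cp + `|mu|) => t; rewrite (le_trans (ler_normD _ _))// lerD.
have [lmu Hlmu] := is_lambda_star_exists bq bpmu.
have lmuE : lmu = l - mu.
  have pairsE lam : bounded_pairs q (fun t => p t + mu) lam = bounded_pairs q p (lam + mu).
    have solE b : solution q (fun t => p t + mu) lam b <-> solution q p (lam + mu) b.
      have E t : - b t ^+ 2 + q t * b t + (p t + mu) + lam =
        - b t ^+ 2 + q t * b t + p t + (lam + mu) by ring.
      by split=> -[acb db]; split=> //; apply: lebesgue_aeS db => t; rewrite E.
    apply/seteqP; split => sx [b [/solE sb bb] bs]; exists b => //; split => //.
  have [_ H _ _ _] := Hl; have [_ Hmu _ _ _] := Hlmu.
  apply/le_anti/andP; split; rewrite leNgt; apply/negP.
    move=> /Hmu; rewrite pairsE subrK => /H; lra.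
  rewrite ltrBrDr => /H; rewrite -pairsE => /Hmu; rewrite ltxx //.
move=> l'; rewrite -lmuE; split=> [Hl'|->//].
exact: is_lambda_star_unique Hl' Hlmu.
Qed.
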